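(* For any signed tree $T$ on $V=V^-\sqcup V^+$, the collection of cones $\{C(S) : S \text{ a signed spine on } T\}$ is a complete simplicial fan in the hyperplane $\mathbb{H}_0=\{x\in\mathbb{R}^V:\sum_{v}x_v=0\}$ (the spine fan).
   Context: $V$ is a finite set partitioned as $V=V^-\sqcup V^+$, $T$ a tree with vertex set $V$. For $X\subseteq V$, $X^\pm=X\cap V^\pm$; $T\setminus U$ is the forest obtained by deleting the vertices of $U$. A signed spine on $T$ is a finite directed tree $S$ whose nodes are labeled by nonempty subsets of $V$ such that (i) the labels partition $V$; (ii) for an arc $r$, let $\mathrm{sc}(r)$ (resp. $\mathrm{sk}(r)$) be the union of labels of the nodes in the component of $S\setminus\{r\}$ containing the tail (resp. head) of $r$; at each node labeled $U$, the sets $\mathrm{sc}(r)$ for distinct incoming arcs lie in pairwise distinct connected components of $T\setminus U^-$, and the sets $\mathrm{sk}(r)$ for distinct outgoing arcs lie in pairwise distinct connected components of $T\setminus U^+$. For a signed spine $S$ write $u\le_S v$ if the node containing $u$ equals, or has a directed path to, the node containing $v$, and $C(S)=\{x\in\mathbb{H}_0: x_u\le x_v \text{ whenever } u\le_S v\}$. *)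

(* Defs.v *)
From HB Require Import structures.
From mathcomp Require Import all_boot all_order all_algebra.
From mathcomp Require Import classical_sets cardinality reals.

Set Implicit Arguments.
Unset Strict Implicit.
Unset Printing Implicit Defensive.

Import Order.TTheory GRing.Theory Num.Theory.

(* In the bound on simple cycles, closed walks x, y, x along one edge have    *)
(* size 2 and are allowed.                                                    *)
Definition is_tree (W : finType) (e : rel W) : Prop :=
  [/\ symmetric e, irreflexive e, 0 < #|W|,
      forall x y, connect e x y & forall c, ucycle e c -> size c <= 2].

Definition del_vertices (W : finType) (e : rel W) (U : {set W}) : rel W :=
  [rel x y | [&& e x y, x \notin U & y \notin U]].

Definition components (W : finType) (e : rel W) (U : {set W}) :
    {set {set W}} :=
  equivalence_partition (connect (del_vertices e U)) (~: U).

Definition in_distinct_components (W : finType) (e : rel W) (U : {set W})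
    (I : finType) (A : {pred I}) (X : I -> {set W}) : Prop :=
  exists K : I -> {set W},
    [/\ {in A, forall i, K i \in components e U},
        {in A, forall i, X i \subset K i} & {in A &, injective K}].

Definition undirected (N : finType) (arc : rel N) : rel N :=
  [rel m n | arc m n || arc n m].

Definition is_directed_tree (N : finType) (arc : rel N) : Prop :=
  is_tree (undirected arc) /\ forall m n, ~~ (arc m n && arc n m).

Definition del_arc (N : finType) (arc : rel N) (a b : N) : rel N :=
  undirected [rel m n | arc m n && ((m, n) != (a, b))].

(* The arc r is given by its tail a and its head b. *)
Definition sc (V N : finType) (arc : rel N) (label : N -> {set V}) (a b : N) :
    {set V} :=
  \bigcup_(n | connect (del_arc arc a b) a n) label n.

Definition sk (V N : finType) (arc : rel N) (label : N -> {set V}) (a b : N) :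
    {set V} :=
  \bigcup_(n | connect (del_arc arc a b) b n) label n.

Record signed_spine (V : finType) (T : rel V) (Vm Vp : {set V}) := SignedSpine {
  node : finType;
  arc : rel node;
  label : node -> {set V};
  arc_tree : is_directed_tree arc;
  label_inj : injective label;
  label_partition : finset.partition [set label n | n : node] [set: V];
  incoming_components : forall n : node,
    in_distinct_components T (label n :&: Vm)
      [pred a | arc a n] (fun a => sc arc label a n);
  outgoing_components : forall n : node,
    in_distinct_components T (label n :&: Vp)
      [pred b | arc n b] (fun b => sk arc label n b) }.

Definition spine_le (V : finType) (T : rel V) (Vm Vp : {set V})
    (S : signed_spine T Vm Vp) (u v : V) : Prop :=
  exists m n : node S,
    [/\ u \in label m, v \in label n & connect (@arc _ _ _ _ S) m n].

Local Open Scope classical_set_scope.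
Local Open Scope ring_scope.

Definition cone_of (R : realType) (E : vectType R) (s : seq E) : set E :=
  [set x | exists c : 'I_(size s) -> R,
     (forall i, 0 <= c i) /\ x = \sum_(i < size s) c i *: s`_i].

Definition polyhedral_cone (R : realType) (E : vectType R) (C : set E) : Prop :=
  exists s : seq E, C = cone_of s.

Definition simplicial_cone (R : realType) (E : vectType R) (C : set E) : Prop :=
  exists s : seq E, free s /\ C = cone_of s.

(* Taking f = 0 shows that a cone is a face of itself. *)
Definition face (R : realType) (E : vectType R) (G C : set E) : Prop :=
  exists f : {scalar E},
    (forall x, C x -> 0 <= f x) /\ G = C `&` [set x | f x = 0].

Definition is_fan (R : realType) (E : vectType R) (F : set (set E)) : Prop :=
  [/\ finite_set F,
      forall C, F C -> polyhedral_cone C,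
      forall C G, F C -> face G C -> F G
    & forall C D, F C -> F D -> face (C `&` D) C /\ face (C `&` D) D].

Definition simplicial_fan (R : realType) (E : vectType R) (F : set (set E)) :
    Prop :=
  is_fan F /\ forall C, F C -> simplicial_cone C.

Definition complete_in (R : realType) (E : vectType R) (H : set E)
    (F : set (set E)) : Prop :=
  \bigcup_(C in F) C = H.

(* R^o, not R, carries the module structure of R over itself. *)
Definition H0 (R : realType) (V : finType) : set {ffun V -> R^o} :=
  [set x : {ffun V -> R^o} | \sum_v x v = 0].
Arguments H0 : clear implicits.

Definition spine_cone (R : realType) (V : finType) (T : rel V)
    (Vm Vp : {set V}) (S : signed_spine T Vm Vp) : set {ffun V -> R^o} :=
  [set x | H0 R V x /\ forall u v, spine_le S u v -> (x u : R) <= x v].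
Arguments spine_cone R [V T Vm Vp] S x.

Definition spine_fan (R : realType) (V : finType) (T : rel V)
    (Vm Vp : {set V}) : set (set {ffun V -> R^o}) :=
  [set C | exists S : signed_spine T Vm Vp, C = spine_cone R S].
Arguments spine_fan R [V] T Vm Vp C.

(* Main.v *)
(* A spine is encoded by its arcs: removing an arc splits V into a source     *)
(* side sc and a sink side sk, contracting an arc forgets its cut, and the    *)
(* label of a node is a class of vertices that no cut separates. A cone is    *)
(* generated by the projections to H_0 of the indicator functions of the sets *)
(* sk, which are independent, so its faces are the cones of its contractions. *)
(* Uniqueness: if x is in the relative interior of the cones of two spines,   *)
(* these cones are equal. When x takes two values, the labels and the arcs    *)
(* are read off T: two low vertices share a label iff no high negative vertex *)
(* separates them, and similar conditions describe the arcs. In general every *)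
(* ray of a spine survives in the contraction to the arcs that cross some     *)
(* level of x, where the two-valued case applies. Hence two cones meet along  *)
(* the common face whose relative interior contains a generic point of the    *)
(* intersection.                                                              *)
(* Completeness: grow a subtree of T by one leaf l, next to p, at a time. If  *)
(* x_p <= x_l, walk up the spine from p, staying in the region of T next to   *)
(* the edge p l, and insert l on the first arc whose head is above x_l, or at *)
(* the end of the walk; the case x_l <= x_p is dual.                          *)
From HB Require Import structures.
Require Import Defs.
From mathcomp Require Import boolp classical_sets cardinality reals.
From mathcomp Require Import all_boot all_order all_algebra ring.

Set Implicit Arguments.
Unset Strict Implicit.
Unset Printing Implicit Defensive.

Import Order.TTheory GRing.Theory Num.Theory.

(** * Separation in trees *)

(** A spine is determined by the bipartitions of V that its arcs induce. The proof therefore works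
    with a [cut_family] and passes to and from spines only through [spine_cut_family] and
    [cut_family_spine]. For functions constant on the labels, the jumps along the arcs are
    coordinates dual to the projected indicators of the cuts ([sum_jumps], [sum_ray_jump]). So a
    cone is simplicial, and a face, where some jumps vanish, is the cone of a contracted spine
    ([cut_family_restrict], [cut_cone_face]).

    Two cones meet in a common face because a point x is in the relative interior of only one cone.
    [strictly_compatible_unique] proves this one cut at a time: contract both spines to the arcs
    that cross a level of x. The contractions have only sources and sinks, and T together with the
    set of high vertices determines them ([two_level_unique]). [cut_cone_inter_face] applies this at
    a generic point of the intersection.

    Completeness is [spine_on_full]: [insertion_place] finds where a new leaf of the subtree enters
    the spine so that x stays compatible, and [cut_family_insert] checks the axioms. Throughout,
    separation in T is reduced to single vertices by [avoidP], and [cut_family_dual] exchanges up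
    and down. *)

Section Avoidance.
Variables (V : finType) (T : rel V).

Implicit Types (U : {set V}) (u v w : V).

(** Since [connect] is reflexive even at deleted vertices, the first conjunct is what makes this
    mean that u and v lie in one component of T with U deleted. *)
Definition avoid (U : {set V}) (u v : V) : bool :=
  (u \notin U) && connect (del_vertices T U) u v.

Lemma avoid_refl U u : u \notin U -> avoid U u u.
Proof. by move=> uU; rewrite /avoid uU connect0. Qed.

Lemma avoid_l U u v : avoid U u v -> u \notin U.
Proof. by case/andP. Qed.

Lemma avoid_r U u v : avoid U u v -> v \notin U.
Proof.
case/andP=> uU /connectP[p]; elim: p u uU => [|y p IHp] u uU /=; first by move=> _ ->.
by case/andP=> /and3P[_ _ yU] pathp; apply: IHp.
Qed.

Lemma avoid_trans U : transitive (avoid U).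
Proof.
move=> v u w /andP[uU uv] /andP[_ vw]; rewrite /avoid uU /=.
exact: connect_trans vw.
Qed.

Lemma avoid_edge U u v : T u v -> u \notin U -> v \notin U -> avoid U u v.
Proof. by move=> uv uU vU; rewrite /avoid uU connect1 // /del_vertices /= uv uU vU. Qed.

Lemma avoid_sub U U' u v : U \subset U' -> avoid U' u v -> avoid U u v.
Proof.
move=> sUU' /andP[uU' uv]; have sub x : x \notin U' -> x \notin U.
  by apply: contra; apply: (subsetP sUU').
rewrite /avoid sub //=; apply: connect_sub uv => x y /and3P[xy xU yU].
by apply: connect1; rewrite /del_vertices /= xy !sub.
Qed.

Lemma avoid_path U u p :
  path T u p -> {in u :: p, forall x, x \notin U} -> avoid U u (last u p).
Proof.
elim: p u => [|y p IHp] u /= pathp pU; first by apply: avoid_refl; apply: pU; rewrite inE.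
case/andP: pathp => uy pathp; apply: (@avoid_trans _ y).
  by apply: avoid_edge => //; apply: pU; rewrite !inE eqxx ?orbT.
by apply: IHp => // x xp; apply: pU; rewrite inE xp orbT.
Qed.

(** A path outside U that also missed w would contradict the separation by w; so it meets w, and its
    part up to w is the required path. *)
Lemma avoid_through U u v w : avoid U u v -> ~~ avoid [set w] u v -> avoid U u w.
Proof.
case/andP=> uU /connectP[p].
elim: p u uU => [|y p IHp] u uU /=.
  move=> _ ->; have [<- _|uw] := eqVneq u w; first exact: avoid_refl.
  by rewrite avoid_refl ?inE.
case/andP=> /and3P[uy _ yU] pathp Ev Nuv.
have [<-|uw] := eqVneq u w; first exact: avoid_refl.
apply: (@avoid_trans _ y); first exact: avoid_edge.
apply: IHp => //; apply: contra Nuv => yv.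
by apply: avoid_trans (yv); apply: avoid_edge; rewrite ?(avoid_l yv) ?inE.
Qed.

Lemma avoid_last U u v : avoid U u v -> u != v ->
  exists2 b, T b v & avoid (v |: U) u b.
Proof.
case/andP=> uU /connectP[p].
elim: p u uU => [|y p IHp] u uU /=; first by move=> _ ->; rewrite eqxx.
case/andP=> /and3P[uy _ yU] pathp Ev Nuv.
have uU' : u \notin v |: U by rewrite !inE negb_or Nuv.
have [yv|Nyv] := eqVneq y v.
  by exists u; [rewrite -yv | apply: avoid_refl].
have [b bv yb] := IHp y yU pathp Ev Nyv; exists b => //.
by apply: avoid_trans (yb); apply: avoid_edge; rewrite ?(avoid_l yb).
Qed.

Hypothesis treeT : is_tree T.

Lemma tree_sym : symmetric T. Proof. by case: treeT. Qed.

Lemma avoid_sym U : symmetric (avoid U).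
Proof.
have sym u v : avoid U u v -> avoid U v u.
  move=> uv; rewrite /avoid (avoid_r uv) /=; case/andP: uv => _.
  rewrite (@sym_connect_sym _ (del_vertices T U)) // => x y /=.
  by rewrite /del_vertices /= tree_sym; congr (_ && _); rewrite andbC.
by move=> u v; apply/idP/idP; apply: sym.
Qed.

(** Acyclicity in the form used below: a simple path from a to b off w closes up through w into a
    simple cycle, which is too long unless a = b. *)
Lemma avoid_neighbors a b w : T a w -> T b w -> avoid [set w] a b -> a = b.
Proof.
move=> aw bw /andP[]; rewrite inE => Naw /connectP[p0 path0 Eb].
case/shortenP: path0 Eb => p pathp uniqp _ Eb.
have pathT : path T a p by apply: sub_path pathp => x y /and3P[].
have wp : w \notin p.
  elim: p a pathp {pathT Eb uniqp aw Naw} => //= y p IHp a /andP[/and3P[_ _]].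
  by rewrite !inE eq_sym negb_or => -> /IHp.
have [symT _ _ _ acyclicT] := treeT.
have: size (w :: a :: p) <= 2.
  apply: acyclicT; apply/andP; split.
    by rewrite /= rcons_path symT aw pathT -Eb.
  by rewrite cons_uniq uniqp inE negb_or eq_sym Naw wp.
by case: p Eb {pathp uniqp pathT wp}.
Qed.

(* A simple path of a tree is its only path between its ends, so a vertex     *)
(* that separates the ends lies on every path.                                *)
Lemma avoidP U u v :
  reflect ({in U, forall w, avoid [set w] u v}) (avoid U u v).
Proof.
apply: (iffP idP) => [uv w wU|uvU]; first by apply: avoid_sub uv; rewrite sub1set.
have [_ _ _ connT _] := treeT; have /connectP[p0 path0 Ev] := connT u v.
case/shortenP: path0 Ev => p pathp uniqp _ ->{v} in uvU *.
apply: avoid_path => // w wp; apply/negP => wU; have uv := uvU w wU.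
have Nuw : u != w by have := avoid_l uv; rewrite inE.
have: last u p != w by have := avoid_r uv; rewrite inE.
move: wp; rewrite inE eq_sym (negPf Nuw) /= => /splitPr Ep; move: Ep uv pathp uniqp {uvU}.
case=> p1 [|b p2]; first by rewrite last_cat /= eqxx.
rewrite last_cat cat_path /= => uv /and4P[path1 aw wb path2].
rewrite mem_cat cat_uniq /= !inE !negb_or.
case/andP=> /andP[Nup1 /and3P[Nu_w Nub Nup2]] /and3P[uniq1 /and3P[Nwp1 Nbp1 _] /andP[/andP[Nwb Nwp2] _]] _.
case/andP: uv => _ uv.
have ua : avoid [set w] u (last u p1).
  apply: avoid_path => // x; rewrite !inE => /orP[/eqP->//|xp1].
  by apply: contraNneq Nwp1 => <-.
have bv : avoid [set w] b (last b p2).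
  apply: avoid_path => // x; rewrite !inE => /orP[/eqP->|xp2].
    by rewrite eq_sym.
  by apply: contraNneq Nwp2 => <-.
have uv' : avoid [set w] u (last b p2) by rewrite /avoid uv inE Nuw.
have ab : last u p1 = b.
  apply: (avoid_neighbors aw); first by rewrite tree_sym.
  apply: avoid_trans (_ : avoid _ u _); first by rewrite avoid_sym.
  by apply: avoid_trans uv' _; rewrite avoid_sym.
have := mem_last u p1; rewrite ab inE (negPf Nbp1) orbF => /eqP bu.
by rewrite bu eqxx in Nub.
Qed.

(** Turns every separation by a label into a separation by one of its vertices; this is how
    conditions on merged labels are reduced to the old ones. *)
Lemma avoidPn U u v : ~~ avoid U u v -> exists2 w, w \in U & ~~ avoid [set w] u v.
Proof.
move=> Nuv; apply/exists_inP; apply: contraR Nuv => /exists_inPn uvU.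
by apply/avoidP => w /uvU; rewrite negbK.
Qed.

End Avoidance.

(** * Cut families and contraction *)

Section CutFamilies.
Variables (V : finType) (T : rel V).

(* Arc i of the spine runs from the node whose label contains t i to the one  *)
(* whose label contains h i, and c i is its sk; e relates the vertices of X   *)
(* that share a label. X is a proper subset of V only while a spine is being  *)
(* built vertex by vertex.                                                    *)
Record cut_family (Vm Vp X : {set V}) (e : rel V) (I : finType) (A : {set I})
    (c : I -> {set V}) (t h : I -> V) : Prop := CutFamily {
  tail_in : forall i, i \in A -> t i \in X;
  head_in : forall i, i \in A -> h i \in X;
  tail_cut : forall i, i \in A -> t i \notin c i;
  head_cut : forall i, i \in A -> h i \in c i;
  cut_other : forall i j, i \in A -> j \in A -> i != j ->
    (t i \in c j) = (h i \in c j);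
  cut_equiv : forall u v i, u \in X -> v \in X -> e u v -> i \in A ->
    (u \in c i) = (v \in c i);
  cut_adjacent : forall u v, u \in X -> v \in X -> ~~ e u v ->
    exists2 i, i \in A &
      ((u \in c i) != (v \in c i)) && (e (t i) u || e (h i) u);
  cut_nested : forall i j u, i \in A -> j \in A -> e (h i) (t j) ->
    u \in X -> u \in c j -> u \in c i;
  in_avoid : forall i u v, i \in A -> u \in X -> v \in X ->
    u \notin c i -> v \notin c i -> avoid T ([set w in X | e (h i) w] :&: Vm) u v;
  in_separated : forall i j u v, i \in A -> j \in A -> i != j ->
    e (h i) (h j) -> u \in X -> v \in X -> u \notin c i -> v \notin c j ->
    ~~ avoid T ([set w in X | e (h i) w] :&: Vm) u v;
  out_avoid : forall i u v, i \in A -> u \in X -> v \in X ->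
    u \in c i -> v \in c i -> avoid T ([set w in X | e (t i) w] :&: Vp) u v;
  out_separated : forall i j u v, i \in A -> j \in A -> i != j ->
    e (t i) (t j) -> u \in X -> v \in X -> u \in c i -> v \in c j ->
    ~~ avoid T ([set w in X | e (t i) w] :&: Vp) u v }.

Definition unseparated (I : finType) (A : {set I}) (c : I -> {set V}) : rel V :=
  [rel u v | [forall i in A, (u \in c i) == (v \in c i)]].

Lemma unseparatedP (I : finType) (A : {set I}) (c : I -> {set V}) u v :
  reflect ({in A, forall i, (u \in c i) = (v \in c i)}) (unseparated A c u v).
Proof. by apply: (iffP forall_inP) => uv i /uv/eqP. Qed.

Lemma unsep_sym (I : finType) (A : {set I}) (c : I -> {set V}) :
  symmetric (unseparated A c).
Proof. by move=> u v; apply/unseparatedP/unseparatedP => uv i /uv. Qed.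

Lemma unsep_trans (I : finType) (A : {set I}) (c : I -> {set V}) :
  transitive (unseparated A c).
Proof.
move=> v u w /unseparatedP uv /unseparatedP vw; apply/unseparatedP => i iA.
by rewrite uv ?vw.
Qed.

Section EquivTheory.
Variables (Vm Vp X : {set V}) (e : rel V) (I : finType) (A : {set I}).
Variables (c : I -> {set V}) (t h : I -> V).
Hypothesis F : cut_family Vm Vp X e A c t h.

(** Vertices of different classes are separated by the cut that [cut_adjacent] provides, so the cuts
    determine the labels. *)
Lemma cut_equivE u v : u \in X -> v \in X -> e u v = unseparated A c u v.
Proof.
move=> uX vX; apply/idP/unseparatedP => [uv i|uv]; first exact: (cut_equiv F).
apply: contraT => /(cut_adjacent F uX vX)[i iA /andP[/negP Nuv _]].
by case: Nuv; rewrite uv.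
Qed.

Lemma cut_refl u : u \in X -> e u u.
Proof. by move=> uX; rewrite cut_equivE //; apply/unseparatedP. Qed.

Lemma cut_sym u v : u \in X -> v \in X -> e u v = e v u.
Proof.
by move=> uX vX; rewrite !cut_equivE //; apply/unseparatedP/unseparatedP => uv i /uv.
Qed.

Lemma cut_trans u v w : u \in X -> v \in X -> w \in X -> e u v -> e v w -> e u w.
Proof.
move=> uX vX wX; rewrite !cut_equivE // => /unseparatedP uv /unseparatedP vw.
by apply/unseparatedP => i iA; rewrite uv ?vw.
Qed.

(** Two arcs into one node have disjoint source sides: a common vertex lies outside the label, so it
    is in one component with itself, against [in_separated]. *)
Lemma in_disjoint i j u : i \in A -> j \in A -> i != j -> e (h i) (h j) ->
  u \in X -> u \notin c i -> u \in c j.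
Proof.
move=> iA jA ij hij uX ui; apply: contraT => uj.
have /negP[] := in_separated F iA jA ij hij uX uX ui uj.
apply: avoid_refl; rewrite !inE; apply/negP => /andP[/andP[_ hu] _].
by have := cut_equiv F (head_in F iA) uX hu iA; rewrite (head_cut F) // (negPf ui).
Qed.

(** Reversing all arcs complements the cuts and exchanges the two signs; each outgoing statement
    then follows from the incoming one. *)
Lemma cut_family_dual : cut_family Vp Vm X e A (fun i => ~: c i) h t.
Proof.
split=> [i|i|i|i|i j|u v i|u v uX vX uv|i j u iA jA hij uX|i u v|i j u v|i u v|i j u v].
- exact: (head_in F).
- exact: (tail_in F).
- by rewrite inE negbK; apply: (head_cut F).
- by rewrite inE; apply: (tail_cut F).
- by move=> iA jA ij; rewrite !inE (cut_other F iA).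
- by move=> uX vX uv iA; rewrite !inE (cut_equiv F uX vX).
- have [i iA /andP[Ni adj]] := cut_adjacent F uX vX uv; exists i => //.
  by rewrite !inE orbC adj andbT; apply: contra Ni => /eqP/negb_inj->.
- rewrite !inE; apply: contra => ui; apply: (cut_nested F jA iA) => //.
  by rewrite cut_sym // ?(head_in F) // ?(tail_in F).
- by rewrite !inE !negbK; apply: (out_avoid F).
- by rewrite !inE !negbK; apply: (out_separated F).
- by rewrite !inE; apply: (in_avoid F).
- by rewrite !inE; apply: (in_separated F).
Qed.

End EquivTheory.

Hypothesis treeT : is_tree T.
#[local] Hint Resolve in_setT : core.

Lemma unseparatedC (I : finType) (A : {set I}) (c : I -> {set V}) u v :
  unseparated A (fun i => ~: c i) u v = unseparated A c u v.
Proof.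
apply/unseparatedP/unseparatedP => uv i /uv; first by rewrite !inE => /negb_inj.
by rewrite !inE => ->.
Qed.

(** * Contraction of one arc *)

Section Removal.
Variables (Vm Vp : {set V}) (e : rel V) (I : finType) (A : {set I}).
Variables (c : I -> {set V}) (t h : I -> V) (k : I).
Hypotheses (F : cut_family Vm Vp [set: V] e A c t h) (kA : k \in A).

Let e' := unseparated (A :\ k) c.

Lemma merge_sub u v : e u v -> e' u v.
Proof.
move=> uv; apply/unseparatedP => i; rewrite !inE => /andP[_ iA].
by rewrite (cut_equiv F _ _ uv iA).
Qed.

(** If u and v were apart and are now merged, the only cut between them is k. [cut_adjacent], read
    from u and from v, puts each at an end of k, and the ends differ because k separates u from
    v. *)
Lemma merge_cases u v : e' u v ->
  [\/ e u v, e (t k) u && e (h k) v | e (t k) v && e (h k) u].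
Proof.
move=> /unseparatedP uv'; have [uv|Nuv] := boolP (e u v); first by constructor 1.
have Nvu : ~~ e v u by rewrite (cut_sym F).
have ktail := tail_cut F kA; have khead := head_cut F kA.
have [i iA /andP[Ni iu]] := cut_adjacent F (in_setT u) (in_setT v) Nuv.
have [j jA /andP[Nj jv]] := cut_adjacent F (in_setT v) (in_setT u) Nvu.
have Ei : i = k by apply: contraNeq Ni => ik; rewrite uv' // !inE ik.
have Ej : j = k by apply: contraNeq Nj => jk; rewrite uv' // !inE jk.
subst i j => {Nj iA jA}.
have Eq x y : e x y -> (x \in c k) = (y \in c k) by move=> xy; apply: (cut_equiv F).
case/orP: iu => iu; case/orP: jv => jv; do ?by constructor 2; rewrite iu jv.
- by rewrite -(Eq _ _ iu) -(Eq _ _ jv) eqxx in Ni.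
- by constructor 3; rewrite iu jv.
- by rewrite -(Eq _ _ iu) -(Eq _ _ jv) eqxx in Ni.
Qed.

Lemma merge_nested i j u : i \in A :\ k -> j \in A :\ k -> e' (h i) (t j) ->
  u \in c j -> u \in c i.
Proof.
rewrite !inE => /andP[ik iA] /andP[jk jA] hij uj.
case: (merge_cases hij) => [|/andP[ti hj]|/andP[tj hi]].
- by move=> {}hij; apply: (cut_nested F iA jA hij).
- apply: (cut_nested F iA kA) => //; first by rewrite (cut_sym F).
  exact: (cut_nested F kA jA).
(* Here i and k share their head, while k and j share their tail: a vertex off [c i] lies in [c k],
   and [c k] is disjoint from [c j]. *)
- apply: contraT => ui.
  have uk : u \in c k by apply: (in_disjoint F iA) => //; rewrite (cut_sym F).
  have := in_disjoint (cut_family_dual F) jA kA jk _ (in_setT u).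
  by rewrite !inE uj uk /= => -> //; rewrite (cut_sym F).
Qed.

(** By [avoidPn] it suffices that no single w of the merged label separates u from v. If w comes
    from the head of k and i enters its tail, the source side of i lies in that of k. If w comes
    from the tail of k and i enters its head, a separating w would be joined to u off the old label,
    although they lie in source sides of different arcs. *)
Lemma merge_in_avoid i u v : i \in A :\ k -> u \notin c i -> v \notin c i ->
  avoid T ([set w in [set: V] | e' (h i) w] :&: Vm) u v.
Proof.
rewrite !inE => /andP[ik iA] ui vi; apply: contraT => /(avoidPn treeT)[w].
rewrite !inE /= => /andP[hw wm] /negP Nuv; case: Nuv.
have old := in_avoid F iA (in_setT u) (in_setT v) ui vi.
case: (merge_cases hw) => [{}hw|/andP[ti hj]|/andP[tw hi]].
- by move/(avoidP treeT): old; apply; rewrite !inE hw.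
- have nest x : x \notin c i -> x \notin c k.
    by apply: contra => xk; apply: (cut_nested F iA kA) => //; rewrite (cut_sym F).
  have /(avoidP treeT) := in_avoid F kA (in_setT u) (in_setT v) (nest _ ui) (nest _ vi).
  by apply; rewrite !inE hj.
- apply: contraT => /(avoid_through old); apply/contraLR => _.
  apply: (in_separated F iA kA ik) => //; first by rewrite (cut_sym F).
  by rewrite -(cut_equiv F _ _ tw kA) // (tail_cut F).
Qed.

(** When i and j enter different ends of k, the one entering the tail has its source side inside
    that of k, which enters the same node as the other; the larger label separates all the more. *)
Lemma merge_in_separated i j u v : i \in A :\ k -> j \in A :\ k -> i != j ->
  e' (h i) (h j) -> u \notin c i -> v \notin c j ->
  ~~ avoid T ([set w in [set: V] | e' (h i) w] :&: Vm) u v.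
Proof.
have e'P : symmetric e' by apply: unsep_sym.
have e'tr : transitive e' by apply: unsep_trans.
have sub x y : e' x y -> [set w in [set: V] | e y w] :&: Vm \subset
    [set w in [set: V] | e' x w] :&: Vm.
  move=> xy; apply: setSI; apply/subsetP => w; rewrite !inE /= => yw.
  by apply: e'tr xy _; apply: merge_sub.
have main i1 j1 u1 v1 : i1 \in A :\ k -> j1 \in A :\ k -> i1 != j1 ->
    e' (h i1) (h j1) -> e (t k) (h i1) -> e (h k) (h j1) ->
    u1 \notin c i1 -> v1 \notin c j1 ->
    ~~ avoid T ([set w in [set: V] | e' (h i1) w] :&: Vm) u1 v1.
  rewrite !inE => /andP[ik iA] /andP[jk jA] ij hij ti hj ui vj.
  have uk : u1 \notin c k.
    by apply: contra ui => ui; apply: (cut_nested F iA kA) => //; rewrite (cut_sym F).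
  have kj : k != j1 by rewrite eq_sym.
  have := in_separated F kA jA kj hj (in_setT u1) (in_setT v1) uk vj.
  apply: contra; apply: avoid_sub; apply: sub; rewrite e'P.
  by apply: e'tr (merge_sub hj) _; rewrite e'P.
move=> iAk jAk ij hij ui vj; have:= iAk; have := jAk.
rewrite !inE => /andP[jk jA] /andP[ik iA].
case: (merge_cases hij) => [hij'|/andP[ti hj]|/andP[tj hi]].
- have := in_separated F iA jA ij hij' (in_setT u) (in_setT v) ui vj.
  by apply: contra; apply: avoid_sub; apply: sub; apply/unseparatedP.
- apply: (main i j u v iAk jAk ij hij ti hj ui vj).
- have -> : [set w in [set: V] | e' (h i) w] = [set w in [set: V] | e' (h j) w].
    by apply/setP => w; rewrite !inE /=; apply/idP/idP; apply: e'tr; rewrite // e'P.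
  by rewrite avoid_sym //; apply: (main j i v u jAk iAk _ _ tj hi vj ui); rewrite 1?eq_sym 1?e'P.
Qed.

End Removal.

Lemma cut_family_remove Vm Vp e (I : finType) (A : {set I}) c t h k : k \in A ->
  cut_family Vm Vp [set: V] e A c t h ->
  cut_family Vm Vp [set: V] (unseparated (A :\ k) c) (A :\ k) c t h.
Proof.
move=> kA F; have sub i : i \in A :\ k -> i \in A by rewrite !inE => /andP[].
have F' := cut_family_dual F.
have lab x : [set w in [set: V] | unseparated (A :\ k) (fun i => ~: c i) x w] =
             [set w in [set: V] | unseparated (A :\ k) c x w].
  by apply/setP => w; rewrite !inE unseparatedC.
split=> // [i /sub|i /sub|i j /sub iA /sub|u v i _ _ /unseparatedP uv|u v _ _ Nuv|
            i j u iA jA hij _|i u v iA _ _|i j u v iA jA ij hij _ _|i u v iA _ _ ui vi|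
            i j u v iA jA ij hij _ _ ui vj].
- exact: (tail_cut F).
- exact: (head_cut F).
- exact: (cut_other F).
- exact: uv.
- have ktail := tail_cut F kA; have khead := head_cut F kA.
  have th : unseparated (A :\ k) c (t k) (h k).
    by apply/unseparatedP => i; rewrite !inE => /andP[ik iA]; rewrite (cut_other F) // eq_sym.
  have Ne x : ~~ unseparated (A :\ k) c x v -> ~~ e x v.
    by apply: contra => /(merge_sub k F).
  have [i iA /andP[Ni iu]] := cut_adjacent F (in_setT u) (in_setT v) (Ne _ Nuv).
  have [ik|ik] := eqVneq i k; last first.
    exists i; first by rewrite !inE ik.
    by rewrite Ni; case/orP: iu => /(merge_sub k F) ->; rewrite ?orbT.
  subst i => {iA}.
  (* The separating cut is k itself, so cross it: u' is at the other end, in the merged class of u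
     and on the same side of k as v. The next separating cut is then not k. *)
  have [u' uu' Nuu'] : exists2 u', unseparated (A :\ k) c u u' & (u \in c k) != (u' \in c k).
    case/orP: iu => iu; [exists (h k)|exists (t k)].
    - by apply: unsep_trans th; rewrite unsep_sym (merge_sub k F).
    - by rewrite -(cut_equiv F _ _ iu kA) // (negPf ktail) khead.
    - by apply: unsep_trans (_ : unseparated _ _ _ (h k)) _; rewrite unsep_sym // (merge_sub k F).
    - by rewrite -(cut_equiv F _ _ iu kA) // (negPf ktail) khead.
  have Nu'v : ~~ unseparated (A :\ k) c u' v.
    by apply: contra Nuv; apply: unsep_trans uu'.
  have [j jA /andP[Nj ju']] := cut_adjacent F (in_setT u') (in_setT v) (Ne _ Nu'v).
  have jk : j != k.
    apply: contraNneq Nj => ->; move: Ni Nuu'.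
    by case: (u \in _); case: (u' \in _); case: (v \in _).
  have jA' : j \in A :\ k by rewrite !inE jk.
  exists j => //; rewrite (unseparatedP _ _ _ _ uu' _ jA') Nj /=.
  rewrite unsep_sym in uu'.
  by case/orP: ju' => /(merge_sub k F)/unsep_trans->; rewrite ?orbT.
- exact: (merge_nested F kA iA jA hij).
- exact: (merge_in_avoid F kA iA).
- exact: (merge_in_separated F kA iA jA ij hij).
- have := @merge_in_avoid _ _ _ _ _ _ _ _ _ F' kA i u v iA.
  by rewrite !inE !negbK lab => ->.
- have := @merge_in_separated _ _ _ _ _ _ _ _ _ F' kA i j u v iA jA ij _.
  by rewrite !inE !negbK lab => -> //; rewrite unseparatedC.
Qed.

End CutFamilies.

(** * Uniqueness of strictly compatible cut families *)

Section Uniqueness.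
Variables (V : finType) (T : rel V).
Hypothesis treeT : is_tree T.
#[local] Hint Resolve in_setT : core.

Lemma cut_family_ext (Vm Vp X : {set V}) (e e' : rel V) (I : finType) (A : {set I}) c t h :
  {in X &, e =2 e'} -> cut_family T Vm Vp X e A c t h ->
  cut_family T Vm Vp X e' A c t h.
Proof.
move=> ee' F; have tX := tail_in F; have hX := head_in F.
have lab x : x \in X -> [set w in X | e' x w] = [set w in X | e x w].
  by move=> xX; apply/setP => w; rewrite !inE; case wX: (w \in X); rewrite //= ee'.
split; do ?by case: F.
- by move=> u v i uX vX; rewrite -ee' //; apply: (cut_equiv F).
- move=> u v uX vX; rewrite -ee' // => /(cut_adjacent F uX vX)[i iA].
  by exists i => //; rewrite -!ee' ?tX ?hX.
- by move=> i j u iA jA; rewrite -ee' ?tX ?hX //; apply: (cut_nested F).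
- by move=> i u v iA; rewrite lab ?tX ?hX //; apply: (in_avoid F).
- by move=> i j u v iA jA; rewrite lab -?ee' ?tX ?hX //; apply: (in_separated F).
- by move=> i u v iA; rewrite lab ?tX ?hX //; apply: (out_avoid F).
- by move=> i j u v iA jA; rewrite lab -?ee' ?tX ?hX //; apply: (out_separated F).
Qed.

Section Restriction.
Variables (Vm Vp : {set V}) (I : finType) (c : I -> {set V}) (t h : I -> V).

Lemma cut_family_restrict e (A B : {set I}) : B \subset A ->
  cut_family T Vm Vp [set: V] e A c t h ->
  cut_family T Vm Vp [set: V] (unseparated B c) B c t h.
Proof.
have [n] := ubnP #|A|; elim: n => // n IHn in e A *; rewrite ltnS => leAn sBA F.
have [sAB|] := boolP (A \subset B).
  have -> : B = A by apply/eqP; rewrite eqEsubset sBA.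
  by apply: cut_family_ext (F) => u v _ _; apply: (cut_equivE F).
case/subsetPn => k kA kB; apply: IHn (cut_family_remove treeT kA F).
  by move: leAn; rewrite (cardsD1 k A) kA.
by apply/subsetP => i iB; rewrite !inE (subsetP sBA) // andbT; apply: contraNneq kB => <-.
Qed.

(** The classes of the contraction arise from the old ones by gluing the two ends of each contracted
    arc, so invariance need only be checked on these. *)
Lemma eq_unseparated (D : Type) (z : V -> D) e (A B : {set I}) : B \subset A ->
  cut_family T Vm Vp [set: V] e A c t h ->
  (forall u v, e u v -> z u = z v) ->
  (forall i, i \in A -> i \notin B -> z (t i) = z (h i)) ->
  forall u v, unseparated B c u v -> z u = z v.
Proof.
have [n] := ubnP #|A|; elim: n => // n IHn in e A *; rewrite ltnS => leAn sBA F ze zAB.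
have [sAB|] := boolP (A \subset B).
  have -> : B = A by apply/eqP; rewrite eqEsubset sBA.
  by move=> u v; rewrite -(cut_equivE F) //; apply: ze.
case/subsetPn => k kA kB; apply: IHn (cut_family_remove treeT kA F) _ _.
- by move: leAn; rewrite (cardsD1 k A) kA.
- by apply/subsetP => i iB; rewrite !inE (subsetP sBA) // andbT; apply: contraNneq kB => <-.
- have zk := zAB k kA kB.
  move=> u v /(merge_cases F kA)[/ze //|/andP[/ze <- /ze <-] //|/andP[/ze <- /ze <-] //].
- by move=> i; rewrite !inE => /andP[_ iA]; apply: zAB.
Qed.

End Restriction.

(** * Spines whose arcs all cross one level *)

Section TwoLevels.
Variables (Vm Vp : {set V}) (e : rel V) (I : finType) (A : {set I}).
Variables (c : I -> {set V}) (t h : I -> V) (H : {set V}).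
Hypothesis F : cut_family T Vm Vp [set: V] e A c t h.
Hypotheses (eH : forall u v, e u v -> (u \in H) = (v \in H)).
Hypotheses (tH : forall i, i \in A -> t i \notin H).
Hypotheses (hH : forall i, i \in A -> h i \in H).

(** A low node has no incoming arc, so the arc that starts the way from u to v leaves the node of u
    and has v beyond it. *)
Lemma below_next u v : u \notin H -> ~~ e u v ->
  exists2 i, i \in A & e (t i) u && (v \in c i).
Proof.
move=> uH Nuv.
have [i iA /andP[Ni /orP[tu|hu]]] := cut_adjacent F (in_setT u) (in_setT v) Nuv.
  exists i; rewrite // tu /=; move: Ni.
  by rewrite -(cut_equiv F _ _ tu iA) // (negPf (tail_cut F iA)) eq_sym eqbF_neg negbK.
by move: uH; rewrite -(eH hu) hH.
Qed.

Lemma above_next u v : u \in H -> ~~ e u v ->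
  exists2 i, i \in A & e (h i) u && (v \notin c i).
Proof.
move=> uH Nuv.
have [i iA /andP[Ni /orP[tu|hu]]] := cut_adjacent F (in_setT u) (in_setT v) Nuv.
  by move: uH; rewrite -(eH tu) (negPf (tH iA)).
exists i; rewrite // hu /=; move: Ni.
by rewrite -(cut_equiv F _ _ hu iA) // (head_cut F iA) eq_sym eqb_id.
Qed.

Lemma notin_tail i u : i \in A -> e (t i) u -> u \notin c i.
Proof. by move=> iA tu; rewrite -(cut_equiv F _ _ tu iA) // (tail_cut F). Qed.

Lemma in_head i u : i \in A -> e (h i) u -> u \in c i.
Proof. by move=> iA hu; rewrite -(cut_equiv F _ _ hu iA) // (head_cut F). Qed.

(** If the nodes of u and v differ, the way from u to v climbs to a high node and leaves it along
    another incoming arc, so the negative part of that label separates u from v. Conversely,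
    vertices sharing a low label are on the source side of one arc into any high node. *)
Lemma below_equivE u v : u \notin H -> v \notin H -> e u v = avoid T (H :&: Vm) u v.
Proof.
move=> uH vH; apply/idP/idP => [uv|].
  apply: contraT => /(avoidPn treeT)[w /setIP[wH wm]] /negP[].
  have Nwu : ~~ e w u by apply: contraL wH => /eH->.
  have [i iA /andP[hw ui]] := above_next wH Nwu.
  have vi : v \notin c i by rewrite -(cut_equiv F _ _ uv iA).
  have /(avoidP treeT) := in_avoid F iA (in_setT u) (in_setT v) ui vi.
  by apply; rewrite !inE hw.
apply: contraLR => Nuv.
have [i iA /andP[tu vi]] := below_next uH Nuv.
have Nhv : ~~ e (h i) v by apply: contra vH => /eH<-; apply: hH.
have [j jA /andP[hji vj]] := above_next (hH iA) Nhv.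
have ij : i != j by apply: contraNneq vj => <-.
have := in_separated F iA jA ij _ (in_setT u) (in_setT v) (notin_tail iA tu) vj.
rewrite (cut_sym F) // => /(_ hji); apply: contra; apply: avoid_sub.
apply/subsetP => w; rewrite !inE /= => /andP[hw ->]; rewrite andbT.
by rewrite -(eH hw) hH.
Qed.

(** The argument of [below_equivE] again: if the first arc from u does not end at the node of v, its
    head is a high node whose negative label separates u from v. The label of v itself must be
    exempted. *)
Lemma below_above_arcP u v : u \notin H -> v \in H ->
  reflect (exists2 i, i \in A & e (t i) u && e (h i) v)
    [forall w in H :&: Vm, ~~ e w v ==> avoid T [set w] u v].
Proof.
move=> uH vH; apply: (iffP forall_inP) => [uv|[i iA /andP[tu hv]] w /setIP[wH wm]].
  have Nuv : ~~ e u v by apply: contraL vH => /eH<-.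
  have [i iA /andP[tu vi]] := below_next uH Nuv; exists i; rewrite // tu /=.
  apply: contraT => Nhv.
  have [j jA /andP[hji vj]] := above_next (hH iA) Nhv.
  have ij : i != j by apply: contraNneq vj => <-.
  have := in_separated F iA jA ij _ (in_setT u) (in_setT v) (notin_tail iA tu) vj.
  rewrite (cut_sym F) // => /(_ hji) /(avoidPn treeT)[w].
  rewrite !inE /= => /andP[hw wm] /negP[].
  have wH : w \in H by rewrite -(eH hw) hH.
  have := uv w; rewrite inE wH wm => /(_ isT)/implyP; apply.
  apply: contra Nhv => wv; exact: (cut_trans F _ _ _ hw wv).
apply/implyP => Nwv; have [j jA /andP[hw vj]] := above_next wH Nwv.
have ij : i != j by apply: contraNneq vj => <-; apply: in_head.
have uj : u \notin c j.
  by rewrite -(cut_equiv F _ _ tu jA) // (cut_other F iA jA ij) // (cut_equiv F _ _ hv jA).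
have /(avoidP treeT) := in_avoid F jA (in_setT u) (in_setT v) uj vj.
by apply; rewrite !inE hw.
Qed.

End TwoLevels.

Definition compatible (R : porderType ring_display) (e : rel V) (I : finType) (A : {set I})
    (t h : I -> V) (z : V -> R) : Prop :=
  (forall u v, e u v -> z u = z v) /\ (forall i, i \in A -> (z (t i) <= z (h i))%R).

Definition strictly_compatible (R : porderType ring_display) (e : rel V) (I : finType)
    (A : {set I}) (t h : I -> V) (z : V -> R) : Prop :=
  (forall u v, e u v -> z u = z v) /\ (forall i, i \in A -> (z (t i) < z (h i))%R).

Section Comparison.
Variables (Vm Vp : {set V}).
Variables (e : rel V) (I : finType) (A : {set I}) (c : I -> {set V}) (t h : I -> V).
Variables (e' : rel V) (I' : finType) (A' : {set I'}) (c' : I' -> {set V}) (t' h' : I' -> V).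
Hypothesis F : cut_family T Vm Vp [set: V] e A c t h.
Hypothesis F' : cut_family T Vm Vp [set: V] e' A' c' t' h'.

(** Labels and arcs have been characterized by T, H and the signs alone, hence they coincide for the
    two families. *)
Lemma two_level_unique (H : {set V}) :
  (forall u v, e u v -> (u \in H) = (v \in H)) ->
  (forall u v, e' u v -> (u \in H) = (v \in H)) ->
  (forall i, i \in A -> (t i \notin H) && (h i \in H)) ->
  (forall i, i \in A' -> (t' i \notin H) && (h' i \in H)) ->
  forall (R : porderType ring_display) (z : V -> R),
  compatible e A t h z -> compatible e' A' t' h' z.
Proof.
move=> eH eH' arcH arcH' R z [ze zA].
have tH i (iA : i \in A) : t i \notin H by case/andP: (arcH i iA).
have hH i (iA : i \in A) : h i \in H by case/andP: (arcH i iA).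
have tH' i (iA : i \in A') : t' i \notin H by case/andP: (arcH' i iA).
have hH' i (iA : i \in A') : h' i \in H by case/andP: (arcH' i iA).
have ee' : e =2 e'.
  move=> u v; have [uH|uH] := boolP (u \in H); have [vH|vH] := boolP (v \in H).
  - have inC i : i \in H -> i \notin ~: H by rewrite inE negbK.
    (* High vertices are the low vertices of the reversed spine, with the complementary level
       set. *)
    have D := below_equivE (cut_family_dual F) (H := ~: H).
    have D' := below_equivE (cut_family_dual F') (H := ~: H).
    rewrite D ?D' ?inC // => [x y /eH'|i iA|i iA|x y /eH|i iA|i iA]; rewrite !inE ?hH ?hH' ?tH ?tH' //.
    by move->.
    by move->.
  - by apply/idP/idP => [/eH|/eH']; rewrite uH (negPf vH).
  - by apply/idP/idP => [/eH|/eH']; rewrite vH (negPf uH).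
  - by rewrite (below_equivE F eH tH hH) // (below_equivE F' eH' tH' hH').
split=> [u v|j jA]; first by rewrite -ee'; apply: ze.
have arcP := below_above_arcP F eH tH hH (tH' j jA) (hH' j jA).
have arcP' := below_above_arcP F' eH' tH' hH' (tH' j jA) (hH' j jA).
have /arcP'/forall_inP arc : exists2 i, i \in A' & e' (t' i) (t' j) && e' (h' i) (h' j).
  by exists j; rewrite ?(cut_refl F').
have /arcP[i iA /andP[/ze <- /ze <-]] : [forall w in H :&: Vm,
    ~~ e w (h' j) ==> avoid T [set w] (t' j) (h' j)].
  by apply/forall_inP => w; rewrite ee'; apply: arc.
exact: zA.
Qed.

End Comparison.

Local Open Scope ring_scope.

(** * Jumps along arcs as coordinates *)

Section Decomposition.
Variables (R : realDomainType) (Vm Vp : {set V}) (e : rel V) (I : finType) (A : {set I}).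
Variables (c : I -> {set V}) (t h : I -> V).
Hypothesis F : cut_family T Vm Vp [set: V] e A c t h.

Lemma jump_cut i j : i \in A -> j \in A ->
  (h j \in c i)%:R - (t j \in c i)%:R = (j == i)%:R :> R.
Proof.
move=> iA jA; have [->|ji] := eqVneq j i.
  by rewrite (head_cut F) // (negPf (tail_cut F iA)) subr0.
by rewrite (cut_other F jA iA ji) subrr.
Qed.

(** Subtracting the combination of indicators leaves [w], constant on labels and without jumps;
    contracting all arcs merges V into one class, so [w] is constant. *)
Lemma sum_jumps (z : V -> R) : (forall u v, e u v -> z u = z v) ->
  forall u v, z v - z u = \sum_(i in A)
    (z (h i) - z (t i)) * ((v \in c i)%:R - (u \in c i)%:R).
Proof.
move=> ze u v.
pose w x := z x - \sum_(i in A) (z (h i) - z (t i)) * (x \in c i)%:R.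
have wuv : w u = w v.
  apply: (eq_unseparated (sub0set A) F (z := w)) => [x y xy|j jA _|].
  - rewrite /w (ze x y xy); congr (_ - _); apply: eq_bigr => i iA.
    by rewrite (cut_equiv F _ _ xy iA).
  - have D : z (h j) = z (t j) + (\sum_(i in A) (z (h i) - z (t i)) * (h j \in c i)%:R
        - \sum_(i in A) (z (h i) - z (t i)) * (t j \in c i)%:R).
      rewrite -sumrB (bigD1 j) //= big1 => [|i /andP[iA ij]].
        by rewrite -mulrBr jump_cut // eqxx mulr1 addr0 addrC subrK.
      by rewrite -mulrBr jump_cut // eq_sym (negPf ij) mulr0.
    by rewrite /w D; ring.
  - by apply/unseparatedP => i; rewrite inE.
have -> : \sum_(i in A) (z (h i) - z (t i)) * ((v \in c i)%:R - (u \in c i)%:R)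
    = (z v - w v) - (z u - w u).
  by rewrite /w !subKr -sumrB; apply: eq_bigr => i _; rewrite mulrBr.
by rewrite wuv; ring.
Qed.

End Decomposition.

Lemma strictly_compatible_unique (R : realDomainType) Vm Vp
    e (I : finType) (A : {set I}) c t h e' (I' : finType) (A' : {set I'}) c' t' h' (x : V -> R) :
  cut_family T Vm Vp [set: V] e A c t h ->
  cut_family T Vm Vp [set: V] e' A' c' t' h' ->
  strictly_compatible e A t h x -> strictly_compatible e' A' t' h' x ->
  forall z : V -> R, compatible e A t h z -> compatible e' A' t' h' z.
Proof.
move=> F F' [xe xA] [xe' xA'] z [ze zA].
(* By [sum_jumps], z is up to a constant a combination of the cut indicators with nonnegative
   coefficients, so one indicator at a time suffices. *)
suff cutF' i : i \in A -> compatible e' A' t' h' (fun u => (u \in c i)%:R : R).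
  have zP := sum_jumps F ze; split=> [u v uv|j jA].
    apply/eqP; rewrite -subr_eq0 zP big1 // => i iA.
    by have [/(_ _ _ uv) -> _] := cutF' i iA; rewrite subrr mulr0.
  rewrite -subr_ge0 zP sumr_ge0 // => i iA; apply: mulr_ge0; rewrite subr_ge0 ?zA //.
  by have [_ ->] := cutF' i iA.
move=> iA; pose s := x (t i); pose H := [set u | s < x u].
pose B := [set i in A | x (t i) <= s < x (h i)].
pose B' := [set i in A' | x (t' i) <= s < x (h' i)].
have sBA : B \subset A by apply/subsetP => j; rewrite inE => /andP[].
have sBA' : B' \subset A' by apply/subsetP => j; rewrite inE => /andP[].
have iB : i \in B by rewrite inE iA lexx xA.
have FB := cut_family_restrict sBA F; have FB' := cut_family_restrict sBA' F'.
have BH j : j \in B -> (t j \notin H) && (h j \in H).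
  by rewrite !inE -leNgt => /andP[].
have BH' j : j \in B' -> (t' j \notin H) && (h' j \in H).
  by rewrite !inE -leNgt => /andP[].
(* A strictly rising arc that does not cross the level has both ends on one side of it, so H is a
   union of classes of each contraction. *)
have outB (a b : R) : a < b -> ~~ (a <= s < b) -> (s < a) = (s < b).
  move=> ab; have [_ /= /negbTE -> //|sa _] := leP a s.
  by rewrite (lt_trans sa ab).
have HB u v : unseparated B c u v -> (u \in H) = (v \in H).
  apply: (eq_unseparated sBA F (z := fun w => w \in H)) => [{}u {}v /xe|j jA].
    by rewrite !inE => ->.
  by rewrite !inE jA; apply: outB; apply: xA.
have HB' u v : unseparated B' c' u v -> (u \in H) = (v \in H).
  apply: (eq_unseparated sBA' F' (z := fun w => w \in H)) => [{}u {}v /xe'|j jA].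
    by rewrite !inE => ->.
  by rewrite !inE jA; apply: outB; apply: xA'.
have [] := two_level_unique FB FB' HB HB' BH BH' (z := fun u => (u \in c i)%:R : R).
  split=> [u v /unseparatedP/(_ i iB) -> //|j /(subsetP sBA) jA].
  by rewrite -subr_ge0 (jump_cut _ F).
move=> eqB' leB'; split=> [u v uv|j jA].
  apply: eqB'; rewrite (cut_equivE F') // in uv; move/unseparatedP: uv => uv.
  by apply/unseparatedP => j /(subsetP sBA'); apply: uv.
have [jB|jB] := boolP (j \in B'); first exact: leB'.
rewrite (eqB' (t' j) (h' j)) //.
apply/unseparatedP => k kB; apply: (cut_other F') => //; first exact: (subsetP sBA').
by apply: contraNneq jB => ->.
Qed.

End Uniqueness.

(** * Insertion of a leaf *)

Section Insertion.
Variables (V : finType) (T : rel V).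
Hypothesis treeT : is_tree T.
Variables (Vm Vp X : {set V}) (I : finType) (A : {set I}).
Variables (c : I -> {set V}) (t h : I -> V).
Hypothesis F : cut_family T Vm Vp X eq_op A c t h.
Variables (p l : V).
Hypotheses (pX : p \in X) (lX : l \notin X) (pl : T p l).
Hypothesis connX : {in X &, forall u v, avoid T (~: X) u v}.

Lemma set_eq_in (Y : {set V}) u : u \in Y -> [set w in Y | u == w] = [set u].
Proof.
move=> uY; apply/setP => w; rewrite !inE eq_sym.
by have [->|] := eqVneq w u; rewrite ?uY ?andbF.
Qed.

Lemma leaf_avoid u v : u \in X -> v \in X -> avoid T [set l] u v.
Proof. by move=> uX vX; apply: avoid_sub (connX uX vX); rewrite sub1set inE. Qed.

(** The edge to p is the only way from l into X. Otherwise l and the last vertex before p on a path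
    inside X would be two neighbors of p in one component off p. *)
Lemma leaf_parent U v : v \in X -> avoid T U l v -> avoid T U p v.
Proof.
move=> vX lv; have [<-|vp] := eqVneq v p; first exact: avoid_refl (avoid_r lv).
apply: (@avoid_trans _ T U l) (lv); rewrite avoid_sym //; apply: avoid_through lv _.
apply/negP => lv; have [b bp vb] := avoid_last (leaf_avoid vX pX) vp.
have lb : l = b.
  apply: (avoid_neighbors treeT _ bp); first by rewrite (tree_sym treeT).
  by apply: avoid_trans lv _; apply: avoid_sub vb; apply: subsetUl.
by have := avoid_r vb; rewrite !inE lb eqxx orbT.
Qed.

(* The node n meets the region of T next to the edge p l; an arc that leaves  *)
(* n inside this region is visible.                                           *)
Definition insertable n :=
  [/\ n \in X,
      forall i, i \in A -> n \notin c i -> p \notin c i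
    & forall i, i \in A -> n \in c i -> avoid T ([set t i] :&: Vp) p (h i)].

Definition visible n i :=
  [&& i \in A, t i == n & avoid T ([set t i] :&: Vp) p (h i)].

(* Some i: l subdivides arc i; None: l becomes a new sink above n.            *)
Definition next_above n (o : option I) : Prop :=
  if o is Some i then visible n i : Prop else forall i, ~~ visible n i.

Variables (n : V) (o : option I).
Hypothesis nP : insertable n.
Hypothesis oP : next_above n o.

Let nX : n \in X. Proof. by case: nP. Qed.
Let neq_l u : u \in X -> (u == l) = false.
Proof. by move=> uX; apply: contraNF lX => /eqP<-. Qed.

Definition proxy u := if u == l then n else u.

(** [None] names the new arc from n to l. Old cuts put l on the side of n; if l subdivides arc i,
    then [c i] lies beyond the new arc and arc i starts at l from now on. *)
Definition ins_cut (j : option I) : {set V} :=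
  if j is Some i then [set u | proxy u \in c i]
  else l |: (if o is Some i then c i else finset.set0).
Definition ins_tail (j : option I) : V :=
  if j is Some i then if o == Some i then l else t i else n.
Definition ins_head (j : option I) : V := if j is Some i then h i else l.
Definition ins_arcs : {set option I} := [set j | if j is Some i then i \in A else true].

Let proxy_l : proxy l = n. Proof. by rewrite /proxy eqxx. Qed.
Let proxy_X u : u \in X -> proxy u = u. Proof. by move=> uX; rewrite /proxy neq_l. Qed.
Let proxy_in u : u \in l |: X -> proxy u \in X.
Proof. by case/setU1P=> [->|uX]; rewrite ?proxy_l ?proxy_X. Qed.

Let tX i : i \in A -> t i \in X. Proof. exact: (tail_in F). Qed.
Let hX i : i \in A -> h i \in X. Proof. exact: (head_in F). Qed.

Let old_in_avoid i u v : i \in A -> u \in X -> v \in X ->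
  u \notin c i -> v \notin c i -> avoid T ([set h i] :&: Vm) u v.
Proof. by move=> iA; rewrite -(set_eq_in (hX iA)); apply: (in_avoid F iA). Qed.

Let old_out_avoid i u v : i \in A -> u \in X -> v \in X ->
  u \in c i -> v \in c i -> avoid T ([set t i] :&: Vp) u v.
Proof. by move=> iA; rewrite -(set_eq_in (tX iA)); apply: (out_avoid F iA). Qed.

Let lN u : u \in X -> l \notin [set u].
Proof. by move=> uX; rewrite inE eq_sym neq_l. Qed.

Let notin_setI u (U W : {set V}) : u \notin U -> u \notin U :&: W.
Proof. by rewrite inE negb_and => ->. Qed.

(** Moves each vertex of an extended source side to an old vertex of that side without meeting the
    label, so that the old axioms apply; for l this vertex is p, by the second clause of
    [insertable]. *)
Let in_proxy i u : i \in A -> u \in l |: X -> proxy u \notin c i ->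
  exists2 u0, (u0 \in X) && (u0 \notin c i) & avoid T ([set h i] :&: Vm) u u0.
Proof.
move=> iA /setU1P[->|uX].
  rewrite proxy_l => ni; have [_ /(_ i iA ni) pi _] := nP.
  exists p; first by rewrite pX.
  apply: avoid_edge; first by rewrite (tree_sym treeT).
    exact: notin_setI (lN (hX iA)).
  by apply: notin_setI; rewrite inE; apply: contraNneq pi => ->; apply: (head_cut F).
rewrite proxy_X // => ui; exists u; first by rewrite uX.
apply/avoid_refl/notin_setI; rewrite inE.
by apply: contraNneq ui => ->; apply: (head_cut F).
Qed.

Let out_proxy i u : i \in A -> u \in l |: X -> proxy u \in c i ->
  exists2 u0, (u0 \in X) && (u0 \in c i) & avoid T ([set t i] :&: Vp) u u0.
Proof.
move=> iA /setU1P[->|uX].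
  rewrite proxy_l => ni; have [_ _ /(_ i iA ni) ph] := nP.
  exists (h i); first by rewrite hX // (head_cut F).
  apply: avoid_trans (ph); apply: avoid_edge; rewrite ?(avoid_l ph) 1?(tree_sym treeT) //.
  exact: notin_setI (lN (tX iA)).
rewrite proxy_X // => ui; exists u; first by rewrite uX.
apply/avoid_refl/notin_setI; rewrite inE.
by apply: contraTneq ui => ->; apply: (tail_cut F).
Qed.

Let new_proxy i u : o = Some i -> u \in l |: X -> u \in ins_cut None ->
  exists2 u0, (u0 \in X) && (u0 \in c i) & avoid T ([set n] :&: Vp) u u0.
Proof.
move=> oi; have := oP; rewrite /next_above oi => /and3P[iA /eqP tn ph] uX'.
rewrite /ins_cut oi => /setU1P[->|ui].
  exists (h i); first by rewrite hX // (head_cut F).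
  rewrite -tn; apply: avoid_trans (ph).
  apply: avoid_edge; rewrite ?(avoid_l ph) 1?(tree_sym treeT) //.
  exact: notin_setI (lN (tX iA)).
case/setU1P: uX' => [ul|uX].
  exists (h i); first by rewrite hX // (head_cut F).
  rewrite ul -tn; apply: avoid_trans (ph).
  apply: avoid_edge; rewrite ?(avoid_l ph) 1?(tree_sym treeT) //.
  exact: notin_setI (lN (tX iA)).
exists u; first by rewrite uX.
apply/avoid_refl/notin_setI; rewrite inE -tn.
by apply: contraTneq ui => ->; apply: (tail_cut F).
Qed.

Let tail_ne i : i \in A -> o != Some i -> ins_tail (Some i) = t i.
Proof. by rewrite /= => _ /negPf->. Qed.

Let o_tail i : o = Some i -> i \in A /\ t i = n.
Proof. by move=> oi; have := oP; rewrite /next_above oi => /and3P[? /eqP]. Qed.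

(** If l subdivides an arc, this is the old separation of that arc from j. If l is a new sink, a
    connection from l to the sink side of j would pass through p and make j visible, against
    [next_above]. *)
Let new_separated j u v : j \in A -> o != Some j -> t j = n ->
  u \in l |: X -> v \in l |: X -> u \in ins_cut None -> proxy v \in c j ->
  ~~ avoid T ([set n] :&: Vp) u v.
Proof.
move=> jA oj tj uX' vX' uN vj; apply/negP => uv.
have [v0 /andP[v0X v0j]] := out_proxy jA vX' vj; rewrite tj => vv0.
have uv0 := avoid_trans uv vv0; case Eo: o => [i|]; have := oP; rewrite /next_above Eo.
  case/and3P=> iA /eqP tn _.
  have [u0 /andP[u0X u0i] uu0] := new_proxy Eo uX' uN.
  have ij : i != j by apply: contraNneq oj => <-; rewrite Eo.
  have := out_separated F iA jA ij _ u0X v0X u0i v0j.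
  rewrite set_eq_in ?tX // tn tj => /(_ (eqxx n))/negP[]; apply: avoid_trans uv0.
  by rewrite avoid_sym.
move/(_ j); rewrite /visible jA tj eqxx /= => /negP[].
have ul : u = l by move: uN; rewrite /= Eo !inE orbF => /eqP.
apply: (@avoid_trans _ _ _ v0); first by apply: leaf_parent => //; rewrite -ul.
by rewrite -tj; apply: old_out_avoid => //; rewrite ?hX ?(head_cut F).
Qed.

Lemma cut_family_insert :
  cut_family T Vm Vp (l |: X) eq_op ins_arcs ins_cut ins_tail ins_head.
Proof.
have lX' : l \in l |: X by rewrite !inE eqxx.
have sX u : u \in X -> u \in l |: X by move=> uX; rewrite inE uX orbT.
have tX' j : j \in ins_arcs -> ins_tail j \in l |: X.
  case: j => [i|_]; last exact: sX.
  by rewrite inE /= => iA; case: ifP => // _; rewrite sX ?tX.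
have hX' j : j \in ins_arcs -> ins_head j \in l |: X.
  by case: j => [i|_] //; rewrite inE => iA; apply/sX/hX.
have lhead j : j \in ins_arcs -> (ins_head j == l) = (j == None).
  by case: j => [i|_]; rewrite ?eqxx // inE /= => iA; rewrite neq_l ?hX.
have ltail j : j \in ins_arcs -> (ins_tail j == l) = (o == j) && (j != None).
  case: j => [i|_]; last by rewrite andbF neq_l.
  by rewrite inE /= andbT => iA; case: (o == Some i); rewrite ?eqxx ?neq_l ?tX.
have ptail i : i \in A -> proxy (ins_tail (Some i)) = t i.
  move=> iA /=; case: eqP => [/o_tail[_ ->]|_]; first exact: proxy_l.
  by rewrite proxy_X ?tX.
have nNone : n \notin ins_cut None.
  rewrite !inE /= neq_l //=; case Eo: o => [i|]; last by rewrite inE.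
  by have [iA <-] := o_tail Eo; rewrite (tail_cut F).
split=> //.
- case=> [i|_] //; rewrite !inE /= => iA.
  by rewrite (ptail i iA) (tail_cut F).
- case=> [i|_]; rewrite !inE /= ?eqxx // => iA.
  by rewrite proxy_X ?hX // (head_cut F).
- case=> [i|] [j|] //; rewrite !inE.
  + by move=> iA jA ij; rewrite (ptail i iA) /= proxy_X ?hX // (cut_other F iA jA).
  + move=> iA _ _ /=; rewrite (neq_l (hX iA)) /=.
    have [Eo|oi] := eqVneq o (Some i); first by rewrite eqxx Eo (head_cut F).
    rewrite (neq_l (tX iA)) /=; case Eo: o oi => [k|] ki; last by rewrite !inE.
    have [kA _] := o_tail Eo; rewrite (cut_other F iA kA) //.
    by apply: contraNneq ki => ->.
  + by move=> _ jA _ /=; rewrite proxy_l proxy_X.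
- by move=> u v j _ _ /eqP->.
- move=> u v uX' vX' uv; case/setU1P: uX' uv => [->|uX] uv.
    have vX : v \in X by case/setU1P: vX' uv => // ->; rewrite eqxx.
    have [vN|vN] := boolP (v \in ins_cut None); last first.
      exists None; first by rewrite inE.
      by rewrite (negPf vN) !inE !eqxx orbT.
    move: vN; rewrite !inE /= neq_l //=; case Eo: o => [i|]; last by rewrite inE.
    move=> vi; have [iA tn] := o_tail Eo; exists (Some i); first by rewrite inE.
    by rewrite !inE /= Eo eqxx proxy_l -tn (negPf (tail_cut F iA)) proxy_X // vi eqxx.
  have [Eu|Nu] := eqVneq u (proxy v).
    have vl : v = l.
      by case/setU1P: vX' uv Eu => // vX; rewrite (proxy_X vX) => /eqP.
    exists None; first by rewrite inE.
    by move: Eu; rewrite vl proxy_l => ->; rewrite (negPf nNone) !inE !eqxx.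
  have [i iA /andP[Ni adj]] := cut_adjacent F uX (proxy_in vX') Nu.
  (* If the separating arc is the subdivided one at its old tail n, it no longer touches n; the new
     arc leaves n and separates the two vertices instead. *)
  have [/andP[/eqP Eo /eqP tu]|No] := boolP ((o == Some i) && (t i == u)).
    have [_ tn] := o_tail Eo; exists None; first by rewrite inE.
    rewrite -tu tn (negPf nNone) [ins_tail _]/= eqxx andbT /=.
    move: Ni; rewrite -tu (negPf (tail_cut F iA)) eq_sym eqbF_neg negbK => vi.
    rewrite eq_sym eqbF_neg negbK !inE Eo.
    by case/setU1P: vX' vi => [->|vX]; rewrite ?eqxx // proxy_X // => ->; rewrite orbT.
  exists (Some i); first by rewrite inE.
  rewrite !inE /= (proxy_X uX) Ni /=; move: No adj; rewrite negb_and.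
  by case: (o == Some i) => //= /negPf->; rewrite orFb => ->; rewrite orbT.
- move=> i j u iA jA ij uX'; case: j jA ij => [j|] jA.
    have jA' : j \in A by rewrite inE in jA.
    have [Eo|oj] := eqVneq o (Some j).
      rewrite [ins_tail _]/= Eo eqxx lhead // => /eqP->; rewrite !inE Eo.
      by case/setU1P: uX' => [->|uX]; rewrite ?eqxx // proxy_X // => ->; rewrite orbT.
    rewrite tail_ne //; case: i iA => [i|] iA; last by rewrite eq_sym neq_l ?tX.
    rewrite inE in iA; rewrite !inE => hij.
    exact: (cut_nested F iA jA' hij (proxy_in uX')).
  case: i iA => [i|] iA; last by rewrite eq_sym neq_l.
  rewrite inE in iA => /eqP hn; rewrite !inE.
  case/setU1P: uX' => [->|uX]; first by rewrite proxy_l -[n]hn (head_cut F).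
  rewrite neq_l //= proxy_X //; case Eo: o => [k|]; last by rewrite inE.
  have [kA tk] := o_tail Eo; apply: (cut_nested F iA kA) => //.
  by rewrite tk; apply/eqP.
- case=> [i|] u v iA uX' vX'; rewrite set_eq_in ?hX' // => ui vi.
    rewrite !inE in iA ui vi.
    have [u0 /andP[u0X u0i] uu0] := in_proxy iA uX' ui.
    have [v0 /andP[v0X v0i]] := in_proxy iA vX' vi; rewrite avoid_sym // => vv0.
    by apply: avoid_trans uu0 (avoid_trans _ vv0); apply: old_in_avoid.
  move: ui vi; rewrite !inE !negb_or => /andP[ul _] /andP[vl _].
  rewrite !inE (negPf ul) (negPf vl) /= in uX' vX'.
  by apply: avoid_sub (leaf_avoid uX' vX'); apply: subsetIl.
- case=> [i|] j u v iA jA ij; last by rewrite eq_sym lhead // eq_sym (negPf ij).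
  case: j jA ij => [j|] jA ij; last by rewrite lhead.
  rewrite set_eq_in ?hX' // => hij uX' vX'; rewrite !inE in iA jA *.
  move=> ui vj; have [u0 /andP[u0X u0i] uu0] := in_proxy iA uX' ui.
  have [v0 /andP[v0X v0j] vv0] := in_proxy jA vX' vj.
  have := in_separated F iA jA ij hij u0X v0X u0i v0j.
  rewrite set_eq_in ?hX //; apply: contra => uv.
  rewrite avoid_sym // in uu0; apply: avoid_trans uu0 (avoid_trans uv _).
  by rewrite (eqP hij).
- case=> [i|] u v iA uX' vX'; rewrite set_eq_in ?tX' //.
    rewrite !inE in iA *; have [Eo|oi] := eqVneq o (Some i).
      have [_ tn] := o_tail Eo.
      have inX w : w \in l |: X -> proxy w \in c i -> w \in X.
        case/setU1P=> // ->; rewrite proxy_l -[n]tn => ti.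
        by have := tail_cut F iA; rewrite ti.
      move=> ui vi; rewrite /= Eo eqxx.
      by apply: avoid_sub (leaf_avoid (inX u uX' ui) (inX v vX' vi)); apply: subsetIl.
    rewrite tail_ne // => ui vi.
    have [u0 /andP[u0X u0i] uu0] := out_proxy iA uX' ui.
    have [v0 /andP[v0X v0i]] := out_proxy iA vX' vi; rewrite avoid_sym // => vv0.
    by apply: avoid_trans uu0 (avoid_trans _ vv0); apply: old_out_avoid.
  rewrite [ins_tail _]/=; case Eo: (o) => [i|] uN vN.
    have [iA' tn] := o_tail Eo.
    have [u0 /andP[u0X u0i] uu0] := new_proxy Eo uX' uN.
    have [v0 /andP[v0X v0i]] := new_proxy Eo vX' vN; rewrite avoid_sym // => vv0.
    by apply: avoid_trans uu0 (avoid_trans _ vv0); rewrite -tn; apply: old_out_avoid.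
  move: uN vN; rewrite !inE Eo !inE !orbF => /eqP-> /eqP->.
  by apply/avoid_refl/notin_setI/lN.
- case=> [i|] [j|] u v iA jA ij //; rewrite set_eq_in ?tX' // => tij uX' vX'.
  + rewrite !inE in iA jA *; have [Eo|oi] := eqVneq o (Some i).
      move: tij; rewrite [ins_tail (Some i)]/= Eo eqxx eq_sym ltail ?inE // Eo.
      by rewrite (negPf ij).
    have [Eo|oj] := eqVneq o (Some j).
      by move: tij; rewrite [ins_tail (Some j)]/= Eo eqxx ltail ?inE // (negPf oi).
    rewrite !tail_ne // in tij *.
    move=> ui vj; have [u0 /andP[u0X u0i] uu0] := out_proxy iA uX' ui.
    have [v0 /andP[v0X v0j] vv0] := out_proxy jA vX' vj.
    have := out_separated F iA jA ij tij u0X v0X u0i v0j.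
    rewrite set_eq_in ?tX //; apply: contra => uv.
    rewrite avoid_sym // in uu0; apply: avoid_trans uu0 (avoid_trans uv _).
    by move: vv0; rewrite -(eqP tij).
  + have oi : o != Some i.
      apply: contraTneq tij => Eo; rewrite [ins_tail None]/= eq_sym.
      by rewrite [ins_tail _]/= Eo eqxx neq_l.
    rewrite inE in iA; rewrite tail_ne // in tij *.
    rewrite inE => ui vN; rewrite avoid_sym // (eqP tij).
    exact: (new_separated iA oi (eqP tij)).
  + have oj : o != Some j.
      apply: contraTneq tij => Eo; rewrite [ins_tail None]/=.
      by rewrite [ins_tail _]/= Eo eqxx neq_l.
    rewrite inE in jA; rewrite (tail_ne jA oj) in tij *.
    rewrite [v \in _]inE => uN vj.
    by apply: (new_separated jA oj) => //; rewrite -(eqP tij).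
Qed.

End Insertion.

(** * Existence of compatible spines *)

Section Existence.
Local Open Scope ring_scope.
Variables (R : realDomainType) (V : finType) (T : rel V).
Hypothesis treeT : is_tree T.

(** Start at p and follow visible arcs while their heads stay below x l. Each move preserves
    [insertable], because only the crossed arc changes sides. *)
Lemma insertion_place (Vm Vp X : {set V}) (I : finType) (A : {set I}) c t h p l
    (x : V -> R) :
  cut_family T Vm Vp X eq_op A c t h -> p \in X -> x p <= x l ->
  exists n o, [/\ insertable T Vp X A c t h p n, x n <= x l,
    next_above T Vp A t h p n o & forall i, o = Some i -> x l <= x (h i)].
Proof.
move=> F pX xpl.
(* The bound k makes the walk terminate: sink sides of visible arcs shrink strictly at each move,
   since the node reached lies in the old sink side but in no new one. *)
suff walk k n : insertable T Vp X A c t h p n -> x n <= x l ->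
    (forall i, visible T Vp A t h p n i -> #|c i :&: X| < k)%N ->
    exists n o, [/\ insertable T Vp X A c t h p n, x n <= x l,
      next_above T Vp A t h p n o & forall i, o = Some i -> x l <= x (h i)].
  apply: (walk #|V|.+1 p) => // [|i _]; last by rewrite ltnS max_card.
  split=> // i iA pi; rewrite -(set_eq_in (tail_in F iA)).
  exact: (out_avoid F iA pX (head_in F iA) pi (head_cut F iA)).
elim: k n => [|k IHk] n nP xn small.
  by exists n, None; split=> // i; apply: contraT => /negbNE/small.
have [i vi|none] := pickP (visible T Vp A t h p n); last first.
  by exists n, None; split=> // i; rewrite none.
have [lei|lti] := leP (x l) (x (h i)).
  by exists n, (Some i); split=> // _ [<-].
have /and3P[iA /eqP tn ph] := vi; have [nX nbelow nabove] := nP.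
apply: (IHk (h i)); last 1 first.
- move=> j /and3P[jA /eqP tj _]; apply: leq_trans (_ : #|c i :&: X| <= k)%N; last first.
    by rewrite -ltnS small.
  apply: proper_card; apply/properP; split.
    apply/subsetP => u; rewrite !inE => /andP[uj uX]; rewrite uX andbT.
    by apply: (cut_nested F iA jA _ uX uj); rewrite tj.
  exists (h i); first by rewrite inE (head_cut F) // (head_in F).
  by rewrite inE -tj (negPf (tail_cut F jA)).
- split=> [|j jA hj|j jA hj]; first exact: (head_in F).
    apply: nbelow => //; rewrite -tn (cut_other F iA jA) //.
    by apply: contraNneq hj => <-; apply: (head_cut F).
  have [<-|ij] := eqVneq i j; first exact: ph.
  by apply: nabove => //; rewrite -tn (cut_other F iA jA).
- exact: ltW.
Qed.

(** All labels are singletons here: completeness is obtained from the maximal cones alone. *)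
Definition spine_on (Vm Vp X : {set V}) (x : V -> R) : Prop :=
  exists (I : finType) (A : {set I}) c t h,
    cut_family T Vm Vp X eq_op A c t h /\ forall i, i \in A -> x (t i) <= x (h i).

Lemma spine_on_dual Vm Vp X (x : V -> R) :
  spine_on Vm Vp X x -> spine_on Vp Vm X (fun u => - x u).
Proof.
move=> [I [A [c [t [h [F xA]]]]]]; exists I, A, (fun i => ~: c i), h, t.
by split; [apply: cut_family_dual | move=> i /xA; rewrite lerN2].
Qed.

Lemma spine_on_extend_up (Vm Vp X : {set V}) (x : V -> R) p l :
  p \in X -> l \notin X -> T p l -> {in X &, forall u v, avoid T (~: X) u v} ->
  x p <= x l -> spine_on Vm Vp X x -> spine_on Vm Vp (l |: X) x.
Proof.
move=> pX lX pl connX xpl [I [A [c [t [h [F xA]]]]]].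
have [n [o [nP xn oP ox]]] := insertion_place F pX xpl.
have F' := cut_family_insert treeT F pX lX pl connX nP oP.
do 5!eexists; split; first exact: F'.
case=> [i|_] //=; rewrite inE => iA; case: eqP => [/ox//|_]; exact: xA.
Qed.

Lemma spine_on_extend (Vm Vp X : {set V}) (x : V -> R) p l :
  p \in X -> l \notin X -> T p l -> {in X &, forall u v, avoid T (~: X) u v} ->
  spine_on Vm Vp X x -> spine_on Vm Vp (l |: X) x.
Proof.
move=> pX lX pl connX; case: (leP (x p) (x l)) => [xpl|/ltW xlp] S.
  exact: (spine_on_extend_up pX lX pl connX).
have [I [A [c [t [h [F xA]]]]]] :
    spine_on Vp Vm (l |: X) (fun u => - x u).
  by apply: (spine_on_extend_up pX lX pl connX); rewrite ?lerN2 //; apply: spine_on_dual.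
exists I, A, (fun i => ~: c i), h, t; split; first exact: cut_family_dual F.
by move=> i /xA; rewrite lerN2.
Qed.

Lemma connected_extend (X : {set V}) p l :
  p \in X -> T p l -> {in X &, forall u v, avoid T (~: X) u v} ->
  {in l |: X &, forall u v, avoid T (~: (l |: X)) u v}.
Proof.
move=> pX pl connX.
have sX u : u \in X -> avoid T (~: (l |: X)) u p.
  by move=> uX; apply: avoid_sub (connX u p uX pX); rewrite setCS subsetUr.
have to_p u : u \in l |: X -> avoid T (~: (l |: X)) u p.
  case/setU1P=> [->|]; last exact: sX.
  by apply: avoid_edge; rewrite 1?(tree_sym treeT) // !inE ?eqxx ?pX ?orbT.
move=> u v uX vX; apply: avoid_trans (to_p u uX) _.
by rewrite avoid_sym //; apply: to_p.
Qed.

Lemma spine_on_full (Vm Vp : {set V}) (x : V -> R) : spine_on Vm Vp [set: V] x.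
Proof.
have [symT _ Vgt0 connT _] := treeT.
have [v0 _] : exists v0 : V, v0 \in V by apply/card_gt0P.
suff grow k : (0 < k <= #|V|)%N -> exists X : {set V}, [/\ #|X| = k,
    {in X &, forall u v, avoid T (~: X) u v} & spine_on Vm Vp X x].
  have [|X [cX _ S]] := grow #|V|; first by rewrite Vgt0 leqnn.
  by have <- : X = [set: V] by apply/eqP; rewrite eqEcard subsetT cardsT cX leqnn.
elim: k => // -[_ _|k IHk ltkV].
  exists [set v0]; split; rewrite ?cards1 //.
    by move=> u v /set1P-> /set1P->; apply: avoid_refl; rewrite !inE negbK.
  exists unit, finset.set0, (fun=> finset.set0), (fun=> v0), (fun=> v0).
  split; last by move=> i; rewrite inE.
  split=> [i|i|i|i|i j|u v i _ _ _|u v|i j u|i u v|i j u v|i u v|i j u v]; rewrite ?inE //.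
  by move=> /eqP-> /eqP->; rewrite eqxx.
have [X [cX connX S]] := IHk (ltnW ltkV).
have [u uX] : exists u, u \in X by apply/card_gt0P; rewrite cX.
have [v _ vX] : exists2 v, v \in [set: V] & v \notin X.
  apply/subsetPn; apply: contraL ltkV => /subset_leq_card.
  by rewrite cardsT cX -ltnNge.
(* A path of T from X to its complement has an edge leaving X, and its outer end is the next
   leaf. *)
have [p [l [pX lX pl]]] : exists p l, [/\ p \in X, l \notin X & T p l].
  have /connectP[q pathq Ev] := connT u v; rewrite {}Ev in vX.
  elim: q u uX pathq vX => [|y q IHq] u uX /=; first by rewrite uX.
  case/andP=> uy pathq lastX; have [yX|yX] := boolP (y \in X); first exact: IHq pathq lastX.
  by exists u, y.
exists (l |: X); split; first by rewrite cardsU1 lX cX.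
  exact: (connected_extend pX pl connX).
exact: (spine_on_extend pX lX pl connX).
Qed.

End Existence.

(** * Directed trees and their bridges *)

Section DirectedTrees.
Variables (N : finType) (arc : rel N).
Hypothesis treeN : is_directed_tree arc.

Definition head_side (a b n : N) : bool := connect (del_arc arc a b) b n.

Lemma del_arc_sym a b : connect_sym (del_arc arc a b).
Proof. by apply: sym_connect_sym => m n; rewrite /del_arc /undirected /= orbC. Qed.

Lemma arc_antisym m n : arc m n -> ~~ arc n m.
Proof. by case: treeN => _ /(_ m n); rewrite negb_and => /orP[/negPf->|]. Qed.

Lemma del_arcE a b x y : undirected arc x y -> (x != a) && (x != b) || (y != a) && (y != b) ->
  del_arc arc a b x y.
Proof.
rewrite /del_arc /undirected /= !xpair_eqE => /orP[->|->] /=; rewrite !negb_and;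
by case/orP=> /andP[-> ->]; rewrite ?orbT.
Qed.

(** Every arc is a bridge: a simple way back from b to a without the arc would close into a long
    cycle, a loop or an opposite arc. *)
Lemma tail_not_head_side a b : arc a b -> ~~ head_side a b a.
Proof.
move=> ab; apply/negP => /connectP[p0 path0 Ea].
case/shortenP: path0 Ea => p pathp uniqp _ Ea.
have [[symN _ _ _ acyclicN] _] := treeN.
have: size (b :: p) <= 2.
  apply: acyclicN; apply/andP; split; last exact: uniqp.
  rewrite /= rcons_path -Ea {2}/undirected /= ab andbT.
  by apply: sub_path pathp => x y; rewrite /del_arc /undirected /= => /orP[] /andP[->]; rewrite ?orbT.
case: p Ea pathp {uniqp} => [/= ab'|d [|//]] /=.
  by move: ab; rewrite ab' => bb; have := arc_antisym bb; rewrite bb.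
move=> <-; rewrite /del_arc /undirected /= eqxx !andbF orbF andbT => /andP[ba _] _.
by have := arc_antisym ab; rewrite ba.
Qed.

Lemma other_arc_side a b a' b' : arc a b -> (a, b) != (a', b') ->
  head_side a' b' a = head_side a' b' b.
Proof.
move=> ab Nab; apply: (same_connect_r (del_arc_sym a' b')).
by apply: connect1; rewrite /del_arc /undirected /= ab Nab.
Qed.

Lemma tail_sideE a b n : arc a b -> connect (del_arc arc a b) a n = ~~ head_side a b n.
Proof.
move=> ab; apply/idP/idP => [an|].
  by rewrite /head_side -(same_connect_r (del_arc_sym a b) an) tail_not_head_side.
suff: connect (del_arc arc a b) a n || head_side a b n by case/orP=> [//|->].
have [[_ _ _ connN _] _] := treeN.
have /connectP[p pathp ->] := connN a n.
suff side x : path (undirected arc) x p ->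
    connect (del_arc arc a b) a x || head_side a b x ->
    connect (del_arc arc a b) a (last x p) || head_side a b (last x p).
  by apply: side; rewrite ?connect0.
elim: p x {pathp} => //= y p IHp x /andP[xy pathp] xP; apply: IHp pathp _.
have [->|ya] := eqVneq y a; first by rewrite connect0.
have [->|yb] := eqVneq y b; first by rewrite /head_side connect0 orbT.
have xy1 : connect (del_arc arc a b) x y.
  by apply: connect1; apply: del_arcE; rewrite // ya yb orbT.
case/orP: xP => xP; apply/orP; [left|right]; exact: connect_trans xP xy1.
Qed.

Lemma next_arc m n : m != n ->
  exists k, arc m k && head_side m k n || arc k m && ~~ head_side k m n.
Proof.
move=> mn; have [[_ _ _ connN _] _] := treeN.
have /connectP[p0 path0 En] := connN m n.
case/shortenP: path0 En => -[|k p] /=; first by move=> _ _ _ mn'; rewrite mn' eqxx in mn.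
case/andP=> mk pathp /andP[]; rewrite inE negb_or => /andP[Nmk mp] _ _ ->.
have kn a b : (m == a) || (m == b) -> connect (del_arc arc a b) k (last k p).
  move=> mab; apply/connectP; exists p => //; elim: p k Nmk mp pathp {mk} => //= y p IHp x.
  move=> xm; rewrite inE negb_or => /andP[ym mp] /andP[xy pathp]; rewrite IHp // andbT.
  rewrite /del_arc /undirected /= !xpair_eqE !negb_and.
  by case/orP: mab => /eqP <-; rewrite ![_ == m]eq_sym xm ym ?orbT !andbT.
exists k; case/orP: mk => mk; rewrite mk /=.
  by rewrite /head_side kn ?eqxx.
by rewrite -(tail_sideE _ mk) kn ?eqxx ?orbT.
Qed.

(** A path that starts at d without the arc from b to d never reaches b, hence never uses the arc
    from a to b. *)
Lemma head_side_nested a b d n : arc a b -> arc b d -> head_side b d n -> head_side a b n.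
Proof.
move=> ab bd /connectP[p pathp ->]; apply: (@connect_trans _ _ d).
  apply: connect1; rewrite /del_arc /undirected /= bd xpair_eqE negb_and /=.
  by rewrite (_ : b != a) //; apply: contraTneq ab => ->; case: treeN => _ /(_ a a); rewrite andbb.
have db := tail_not_head_side bd.
have side x q : head_side b d x -> path (del_arc arc b d) x q -> b \notin x :: q.
  elim: q x => [|y q IHq] x xd /=.
    by rewrite inE => _; apply: contraNneq db => {2}->.
  case/andP=> xy pathq; rewrite inE negb_or IHq // ?andbT.
    by apply: contraNneq db => {2}->.
  exact: connect_trans xd (connect1 xy).
have avoid_b x q : path (del_arc arc b d) x q -> b \notin x :: q -> path (del_arc arc a b) x q.
  elim: q x => //= y q IHq x /andP[xy pathq]; rewrite inE negb_or => /andP[bx byq].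
  rewrite IHq // andbT; move: byq; rewrite inE negb_or => /andP[by_ _].
  move: xy; rewrite /del_arc /undirected /= !xpair_eqE !negb_and.
  by case/orP=> /andP[-> _]; rewrite ?(eq_sym x b) ?(eq_sym y b) bx by_ ?orbT.
apply/connectP; exists p => //; apply: avoid_b (pathp) _.
by apply: side (pathp); apply: connect0.
Qed.

End DirectedTrees.

(** The remainder of a longer simple cycle would bypass one of its edges, which is then no
    bridge. *)
Lemma bridges_directed_tree (N : finType) (arc : rel N) :
  0 < #|N| -> (forall a b, arc a b -> ~~ head_side arc a b a) ->
  (forall m n, ~~ (arc m n && arc n m)) ->
  (forall m n, connect (undirected arc) m n) -> is_directed_tree arc.
Proof.
move=> N_gt0 bridge anti conn; split=> //.
have symN : symmetric (undirected arc) by move=> m n; rewrite /undirected /= orbC.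
split=> //; first by move=> m; have := anti m m; rewrite andbb /undirected /= orbb => /negPf.
case=> [|a [|b [|d q]]] //= /andP[cyc uniqc]; exfalso.
have {cyc} [ab [bd pathq]] : undirected arc a b /\ undirected arc b d /\
    path (undirected arc) d (rcons q a) by move: cyc => /= /and3P[].
move: uniqc; rewrite !cons_uniq !inE !negb_or.
case/and4P=> /and3P[Nab Nad aq] /andP[Nbd bq] _ _.
have bypass x y : (x == a) && (y == b) || (x == b) && (y == a) ->
    connect (del_arc arc x y) b a.
  move=> xy; have Da m n : undirected arc m n ->
      (m != a) && (m != b) || (n != a) && (n != b) -> del_arc arc x y m n.
    move=> mn mnab; apply: del_arcE mn _.
    by case/orP: xy => /andP[/eqP-> /eqP->]; rewrite // ![_ && (_ != a)]andbC.
  apply: (@connect_trans _ _ d).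
    by apply: connect1; apply: Da; rewrite // ![d == _]eq_sym Nad Nbd orbT.
  elim: q d Nad Nbd aq bq pathq {bd} => [|z q IHq] d Nad Nbd aq bq /=.
    rewrite andbT => da; apply: connect1; apply: Da => //.
    by rewrite ![d == _]eq_sym Nad Nbd.
  move: aq bq; rewrite !inE !negb_or => /andP[az aq] /andP[bz bq] /andP[dz pathq].
  apply: (@connect_trans _ _ z).
    by apply: connect1; apply: Da; rewrite // ![z == _]eq_sym az bz orbT.
  exact: IHq.
case/orP: ab => ab; have := bridge _ _ ab; rewrite /head_side.
  by rewrite bypass ?eqxx.
by rewrite del_arc_sym bypass ?eqxx ?orbT.
Qed.

(** * From spines to cut families *)

Section Conversion.
Variables (V : finType) (T : rel V).
Hypothesis treeT : is_tree T.
#[local] Hint Resolve in_setT : core.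

(** Replaces the choice of components by pairwise conditions; each set being nonempty, its component
    is that of any of its elements. *)
Lemma in_distinct_componentsP (U : {set V}) (J : finType) (A : {pred J}) (X : J -> {set V}) :
  {in A, forall i, exists u, u \in X i} ->
  in_distinct_components T U A X <->
  {in A, forall i, {in X i &, forall u v, avoid T U u v}} /\
  {in A &, forall i j, i != j -> {in X i & X j, forall u v, ~~ avoid T U u v}}.
Proof.
move=> X0; split=> [[K [Kcomp sXK injK]]|[XA XN]].
  have inK i u v : i \in A -> u \in K i -> (v \in K i) = avoid T U u v.
    move=> iA; case/imsetP: (Kcomp i iA) => x xU ->; rewrite !inE => /andP[uU xu].
    apply/andP/idP => [[vU xv]|uv].
      apply: (@avoid_trans _ _ _ x); last by rewrite /avoid xv -in_setC xU.
      by rewrite avoid_sym // /avoid xu -in_setC xU.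
    split; first exact: avoid_r uv.
    by case/andP: uv => _; apply: connect_trans.
  split=> [i iA u v /(subsetP (sXK i iA)) uK /(subsetP (sXK i iA)) vK|i j iA jA ij u v].
    by rewrite -(inK i).
  move=> /(subsetP (sXK i iA)) uK /(subsetP (sXK j jA)) vK; apply: contra ij => uv.
  apply/eqP/injK => //; apply/setP => w; rewrite (inK i u) // (inK j v) //.
  apply/idP/idP; last exact: avoid_trans.
  by rewrite avoid_sym // in uv; apply: avoid_trans.
pose K i := if [pick u in X i] is Some u
  then [set y in ~: U | connect (del_vertices T U) u y] else finset.set0.
have KP i : i \in A -> exists2 u, u \in X i &
    K i = [set y in ~: U | connect (del_vertices T U) u y].
  move=> iA; rewrite /K; case: pickP => [u uX|X0i]; first by exists u.
  by have [u] := X0 i iA; rewrite X0i.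
exists K; split=> [i iA|i iA|i j iA jA Kij].
- have [u uX ->] := KP i iA; apply: (imset_f (fun x => [set y in ~: U | connect (del_vertices T U) x y])).
  by rewrite inE (avoid_l (XA i iA u u uX uX)).
- have [u uX ->] := KP i iA; apply/subsetP => v vX; have uv := XA i iA u v uX vX.
  by rewrite !inE (avoid_r uv); case/andP: uv.
- have [u uX Ei] := KP i iA; have [v vX Ej] := KP j jA.
  apply/eqP; apply: contraT => ij; case/negP: (XN i j iA jA ij u v uX vX).
  have: v \in K i by rewrite Kij Ej inE connect0 in_setC (avoid_l (XA j jA v v vX vX)).
  by rewrite Ei inE /avoid => /andP[_ ->]; rewrite (avoid_l (XA i iA u u uX uX)).
Qed.

Section OfSpine.
Variables (Vm Vp : {set V}) (S : signed_spine T Vm Vp).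
Notation N := (node S).
Notation arcS := (@Defs.arc _ _ _ _ S).
Notation lab := (@label _ _ _ _ S).

Lemma label_nonempty (n : N) : exists u, u \in lab n.
Proof.
apply/set0Pn; have /and3P[_ _ no0] := label_partition S.
by apply: contraNneq no0 => <-; apply: imset_f.
Qed.

Lemma label_cover u : exists n : N, u \in lab n.
Proof.
have /and3P[/eqP cov _ _] := label_partition S.
have: u \in cover [set lab n | n : N] by rewrite cov.
by case/bigcupP => _ /imsetP[n _ ->]; exists n.
Qed.

Lemma label_unique u (m n : N) : u \in lab m -> u \in lab n -> m = n.
Proof.
have /and3P[_ triv _] := label_partition S => um un.
apply/label_inj/eqP; apply: contraT => mn.
have /trivIsetP := triv => /(_ (lab m) (lab n)).
rewrite !imset_f // => /(_ isT isT mn) /disjoint_setI0/setP/(_ u).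
by rewrite !inE um un.
Qed.

Lemma spine_le_monotone (R : porderType ring_display) (z : V -> R) :
  (forall u v, spine_le S u v -> (z u <= z v)%R) <->
  (forall n : N, {in lab n &, forall u v, z u = z v}) /\
  (forall m n : N, arcS m n -> {in lab m & lab n, forall u v, (z u <= z v)%R}).
Proof.
split=> [zle|[zlab zarc] u v [m [n [um vn]]] /connectP[p]].
  split=> [n u v un vn|m n mn u v um vn].
    by apply/eqP; rewrite eq_le !zle //; exists n, n; rewrite connect0.
  by apply: zle; exists m, n; rewrite connect1.
elim: p m u um => [|y p IHp] m u um /=; first by move=> _ En; rewrite (zlab m u v) // -En.
case/andP=> my pathp Ev; have [w wy] := label_nonempty y.
by apply: le_trans (zarc m y my u w um wy) _; apply: IHp pathp Ev.
Qed.

(** Arcs become pairs of nodes, cuts become sink sides, and a representative of each label names its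
    node. [next_arc] gives adjacency and [head_side_nested] gives nesting. *)
Lemma spine_cut_family :
  exists e (I : finType) (A : {set I}) c t h, cut_family T Vm Vp [set: V] e A c t h /\
    forall (R : porderType ring_display) (z : V -> R),
    compatible e A t h z <-> forall u v, spine_le S u v -> (z u <= z v)%R.
Proof.
have [rep repP] := fin_all_exists label_nonempty.
have [nd ndP] := fin_all_exists label_cover.
have ndE u n : (u \in lab n) = (nd u == n).
  by apply/idP/eqP => [un|<-//]; apply: label_unique un.
have ndrep n : nd (rep n) = n by apply/eqP; rewrite -ndE.
have treeS := arc_tree S.
have skE a b u : (u \in sk arcS lab a b) = head_side arcS a b (nd u).
  apply/bigcupP/idP => [[n bn]|bn]; first by rewrite ndE => /eqP->.
  by exists (nd u).
have scE a b u : arcS a b -> (u \in sc arcS lab a b) = ~~ head_side arcS a b (nd u).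
  move=> ab; rewrite -(tail_sideE treeS _ ab); apply/bigcupP/idP => [[n bn]|bn].
    by rewrite ndE => /eqP->.
  by exists (nd u).
pose e u v := nd u == nd v.
have lsetE n : [set w in [set: V] | e (rep n) w] = lab n.
  by apply/setP => w; rewrite inE /= /e ndrep eq_sym ndE in_setT.
have inP n : in_distinct_components T (lab n :&: Vm) [pred a | arcS a n] (fun a => sc arcS lab a n).
  exact: incoming_components.
have outP n : in_distinct_components T (lab n :&: Vp) [pred b | arcS n b] (fun b => sk arcS lab n b).
  exact: outgoing_components.
have inX n : {in [pred a | arcS a n], forall a, exists u, u \in sc arcS lab a n}.
  by move=> a an; exists (rep a); rewrite scE // ndrep tail_not_head_side.
have outX n : {in [pred b | arcS n b], forall b, exists u, u \in sk arcS lab n b}.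
  by move=> b nb; exists (rep b); rewrite skE ndrep /head_side connect0.
have {inP} inP n := (in_distinct_componentsP _ (inX n)).1 (inP n).
have {outP} outP n := (in_distinct_componentsP _ (outX n)).1 (outP n).
have inA a n u v : arcS a n -> ~~ head_side arcS a n (nd u) ->
    ~~ head_side arcS a n (nd v) -> avoid T (lab n :&: Vm) u v.
  by move=> an; rewrite -!scE // => ua va; have [/(_ a an u v ua va)] := inP n.
have inN a b n u v : arcS a n -> arcS b n -> a != b -> ~~ head_side arcS a n (nd u) ->
    ~~ head_side arcS b n (nd v) -> ~~ avoid T (lab n :&: Vm) u v.
  move=> an bn ab; rewrite -!scE // => ua vb.
  by have [_ /(_ a b an bn ab u v ua vb)] := inP n.
have outA n b u v : arcS n b -> head_side arcS n b (nd u) ->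
    head_side arcS n b (nd v) -> avoid T (lab n :&: Vp) u v.
  by move=> nb; rewrite -!skE // => ub vb; have [/(_ b nb u v ub vb)] := outP n.
have outN n a b u v : arcS n a -> arcS n b -> a != b -> head_side arcS n a (nd u) ->
    head_side arcS n b (nd v) -> ~~ avoid T (lab n :&: Vp) u v.
  move=> na nb ab; rewrite -!skE // => ua vb.
  by have [_ /(_ a b na nb ab u v ua vb)] := outP n.
exists e, (N * N)%type, [set r | arcS r.1 r.2], (fun r => sk arcS lab r.1 r.2),
  (fun r => rep r.1), (fun r => rep r.2).
split.
  split=> // [[a b]|[a b]|[a b] [a' b']|u v [a b] _ _ /eqP uv _|u v _ _ uv|[a b] [a' d] u|
      [a b] u v|[a b] [a' b'] u v|[a b] u v|[a b] [a' b'] u v]; rewrite ?skE ?inE /=.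
  - by rewrite ndrep; apply: tail_not_head_side.
  - by rewrite ndrep /head_side connect0.
  - by move=> ab _ Nab; rewrite ?skE !ndrep; apply: other_arc_side.
  - by rewrite ?skE uv.
  - have [k] := next_arc treeS uv; case/orP=> /andP[mk side].
      exists (nd u, k); first by rewrite inE.
      by rewrite ?skE /= side (negPf (tail_not_head_side treeS mk)) /e !ndrep eqxx.
    exists (k, nd u); first by rewrite inE.
    by rewrite ?skE /= (negPf side) /head_side connect0 /e !ndrep eqxx orbT.
  - rewrite /e !ndrep => ab ad /eqP Eb _; rewrite ?skE; rewrite -Eb in ad *.
    exact: (head_side_nested treeS).
  - by move=> ab _ _; rewrite ?skE lsetE; apply: inA.
  - move=> ab ab' Nr Eb _ _; rewrite ?skE lsetE; move: Eb; rewrite /e !ndrep => /eqP Eb.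
    rewrite -Eb in ab' Nr *; apply: inN => //.
    by apply: contra Nr => /eqP->.
  - by move=> ab _ _; rewrite ?skE lsetE; apply: outA.
  - move=> ab ab' Nr Eb _ _; rewrite ?skE lsetE; move: Eb; rewrite /e !ndrep => /eqP Eb.
    rewrite -Eb in ab' Nr *; apply: outN => //.
    by apply: contra Nr => /eqP->.
move=> R z; rewrite spine_le_monotone /compatible; split=> -[zE zA]; split.
- by move=> n u v; rewrite !ndE => /eqP un /eqP vn; apply: zE; rewrite /e un vn.
- move=> m n mn u v; rewrite !ndE => /eqP um /eqP vn.
  have := zA (m, n); rewrite inE /= => /(_ mn).
  by rewrite (zE (rep m) u) ?(zE (rep n) v) // /e ndrep ?um ?vn.
- by move=> u v uv; apply: (zE (nd u)); rewrite ndE // -(eqP uv).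
- by case=> m n; rewrite inE /= => mn; apply: (zA m n).
Qed.

End OfSpine.

End Conversion.

(** * From cut families to spines *)

Section ToSpine.
Variables (V : finType) (T : rel V).
Hypothesis treeT : is_tree T.
#[local] Hint Resolve in_setT : core.
Variables (Vm Vp : {set V}) (e : rel V) (I : finType) (A : {set I}).
Variables (c : I -> {set V}) (t h : I -> V).
Hypothesis F : cut_family T Vm Vp [set: V] e A c t h.

Definition class_node := {K : {set V} | K \in equivalence_partition e [set: V]}.

Definition node_of (u : V) : class_node :=
  exist _ [set v in [set: V] | e u v]
    (imset_f (fun x => [set v in [set: V] | e x v]) (in_setT u)).

Definition class_arc : rel class_node :=
  fun m n => [exists i in A, (t i \in val m) && (h i \in val n)].

Let e_refl u : e u u. Proof. exact: (cut_refl F). Qed.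
Let e_sym u v : e u v = e v u. Proof. exact: (cut_sym F). Qed.
Let e_trans u v w : e u v -> e v w -> e u w. Proof. exact: (cut_trans F). Qed.

Let in_node u v : (v \in val (node_of u)) = e u v.
Proof. by rewrite /= !inE. Qed.

Let node_eq u v : (node_of u == node_of v) = e u v.
Proof.
apply/eqP/idP => [E|uv]; first by rewrite -in_node E in_node.
apply/val_inj/setP => w; rewrite !in_node.
by apply/idP/idP; apply: e_trans; rewrite // e_sym.
Qed.

Let node_onto (n : class_node) : exists u, n = node_of u.
Proof.
by case: n => K KP; have /imsetP[u _ Ku] := KP; exists u; apply/val_inj.
Qed.

Let arcP u v : reflect (exists2 i, i \in A & e (t i) u /\ e (h i) v)
  (class_arc (node_of u) (node_of v)).
Proof.
apply: (iffP exists_inP) => -[i iA].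
  by rewrite !in_node => /andP[ut vh]; exists i; rewrite // e_sym ut e_sym vh.
by case=> ut vh; exists i; rewrite // !in_node e_sym ut e_sym vh.
Qed.

Let arc_of i : i \in A -> class_arc (node_of (t i)) (node_of (h i)).
Proof. by move=> iA; apply/arcP; exists i. Qed.

Let class_arc_antisym m n : ~~ (class_arc m n && class_arc n m).
Proof.
have [u ->] := node_onto m; have [v ->] := node_onto n.
apply/andP => -[/arcP[i iA [tu hv]] /arcP[j jA [tv hu]]].
have eqc x y k : e x y -> k \in A -> (x \in c k) = (y \in c k).
  by move=> xy kA; apply: (cut_equiv F).
have [ij|ij] := eqVneq i j.
  subst j; have := tail_cut F iA; rewrite (eqc _ u) // -(eqc _ _ _ hu) //.
  by rewrite (head_cut F).
have := cut_other F iA jA ij.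
by rewrite (eqc _ u) // -(eqc _ _ _ hu) // (eqc (h i) v) // -(eqc _ _ _ tv) // (head_cut F) ?(negPf (tail_cut F jA)).
Qed.

(** Arcs other than i have both ends on one side of [c i]. Hence every arc is a bridge, and its two
    sides are the complement of [c i] and [c i]. *)
Let del_arc_side i u v : i \in A ->
  connect (del_arc class_arc (node_of (t i)) (node_of (h i))) (node_of u) (node_of v) ->
  (u \in c i) = (v \in c i).
Proof.
move=> iA /connectP[p]; elim: p u => [|n p IHp] u /=.
  move=> _ /eqP; rewrite node_eq e_sym => uv; exact: (cut_equiv F).
have [w ->] := node_onto n; case/andP=> uw pathp lastv.
rewrite -(IHp w pathp lastv).
have side x y : class_arc (node_of x) (node_of y) &&
    ((node_of x, node_of y) != (node_of (t i), node_of (h i))) -> (x \in c i) = (y \in c i).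
  case/andP=> /arcP[j jA [tx hy]] Nij.
  have ji : j != i.
    apply: contraNneq Nij => ji; rewrite xpair_eqE !node_eq -ji.
    by rewrite e_sym tx e_sym hy.
  rewrite -(cut_equiv F _ _ tx iA) // -(cut_equiv F _ _ hy iA) //.
  exact: (cut_other F jA iA).
by case/orP: uw => /side.
Qed.

(** Induction on the number of cuts between u and v: one of them has an end at the node of u, and
    crossing its arc changes sides for that cut alone. *)
Let class_arc_connected m n : connect (undirected class_arc) m n.
Proof.
have [u ->] := node_onto m; have [v ->] := node_onto n => {m n}.
have symN : connect_sym (undirected class_arc).
  by apply: sym_connect_sym => m n; rewrite /undirected /= orbC.
have arc_connect i : i \in A ->
    connect (undirected class_arc) (node_of (t i)) (node_of (h i)).
  by move=> iA; apply: connect1; rewrite /undirected /= arc_of.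
pose sep x := [set i in A | (x \in c i) != (v \in c i)].
have [k] := ubnP #|sep u|; elim: k => // k IHk in u *; rewrite ltnS => leuk.
have [uv|Nuv] := boolP (e u v).
  by move: uv; rewrite -node_eq => /eqP->; apply: connect0.
have [i iA /andP[Ni adj]] := cut_adjacent F (in_setT u) (in_setT v) Nuv.
have [u' [uu' Nu' other]] : exists u', [/\ connect (undirected class_arc) (node_of u) (node_of u'),
    (u' \in c i) = (v \in c i) & {in A, forall j, j != i -> (u' \in c j) = (u \in c j)}].
  case/orP: adj => adj; [exists (h i)|exists (t i)]; split.
  - by move: (adj); rewrite -node_eq => /eqP<-; apply: arc_connect.
  - move: Ni; rewrite (head_cut F) // -(cut_equiv F _ _ adj iA) // (negPf (tail_cut F iA)).
    by case: (v \in c i).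
  - by move=> j jA ji; rewrite -(cut_equiv F _ _ adj jA) // -(cut_other F iA jA) // eq_sym.
  - by rewrite symN; move: (adj); rewrite -node_eq => /eqP<-; apply: arc_connect.
  - move: Ni; rewrite (negPf (tail_cut F iA)) -(cut_equiv F _ _ adj iA) // (head_cut F) //.
    by case: (v \in c i).
  - by move=> j jA ji; rewrite -(cut_equiv F _ _ adj jA) // (cut_other F iA jA) // eq_sym.
apply: connect_trans uu' (IHk u' _); apply: leq_trans leuk.
apply: proper_card; apply/properP; split.
  apply/subsetP => j; rewrite !inE => /andP[jA]; rewrite jA.
  by have [->|ji] := eqVneq j i; rewrite ?Nu' ?eqxx // other.
by exists i; rewrite !inE iA ?Ni // Nu' eqxx.
Qed.

Let class_arc_tree : is_directed_tree class_arc.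
Proof.
apply: (bridges_directed_tree _ _ class_arc_antisym class_arc_connected).
- have [_ _ /card_gt0P[v _] _ _] := treeT.
  by apply/card_gt0P; exists (node_of v).
- move=> x y; have [u ->] := node_onto x; have [v ->] := node_onto y.
  case/arcP=> i iA [tu hv]; have /eqP <- : node_of (t i) == node_of u by rewrite node_eq.
  have /eqP <- : node_of (h i) == node_of v by rewrite node_eq.
  apply/negP => /(del_arc_side iA).
  by rewrite (head_cut F) // (negPf (tail_cut F iA)).
Qed.

Let head_sideE i u : i \in A ->
  head_side class_arc (node_of (t i)) (node_of (h i)) (node_of u) = (u \in c i).
Proof.
move=> iA; apply/idP/idP => [/(del_arc_side iA) <-|]; first exact: (head_cut F).
apply: contraTT; rewrite -(tail_sideE class_arc_tree _ (arc_of iA)).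
by move/(del_arc_side iA) <-; apply: (tail_cut F).
Qed.

Let class_label (n : class_node) : {set V} := val n.

Let class_sk i : i \in A ->
  sk class_arc class_label (node_of (t i)) (node_of (h i)) = c i.
Proof.
move=> iA; apply/setP => u; rewrite -(head_sideE u iA).
apply/bigcupP/idP => [[n]|hu]; last by exists (node_of u); rewrite // in_node.
by have [v ->] := node_onto n; rewrite in_node -node_eq => + /eqP<-.
Qed.

Let class_sc i : i \in A ->
  sc class_arc class_label (node_of (t i)) (node_of (h i)) = ~: c i.
Proof.
move=> iA; apply/setP => u; rewrite inE -(head_sideE u iA).
rewrite -(tail_sideE class_arc_tree _ (arc_of iA)).
apply/bigcupP/idP => [[n]|hu]; last by exists (node_of u); rewrite // in_node.
by have [v ->] := node_onto n; rewrite in_node -node_eq => + /eqP<-.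
Qed.

Let class_partition :
  finset.partition [set class_label n | n : class_node] [set: V].
Proof.
have -> : [set class_label n | n : class_node] = equivalence_partition e [set: V].
  apply/setP => K; apply/imsetP/idP => [[n _ ->]|KP]; first exact: valP.
  by exists (exist _ K KP).
apply: equivalence_partitionP => u v w _ _ _; split=> // uv.
by apply/idP/idP; apply: e_trans; rewrite // e_sym.
Qed.

Let class_incoming (n : class_node) : in_distinct_components T (class_label n :&: Vm)
  [pred a | class_arc a n] (fun a => sc class_arc class_label a n).
Proof.
have [v ->] := node_onto n.
have scP a : class_arc a (node_of v) -> exists2 i, i \in A &
    [/\ a = node_of (t i), e (h i) v & sc class_arc class_label a (node_of v) = ~: c i].
  have [u ->] := node_onto a; case/arcP=> i iA [tu hv]; exists i => //.
  have /eqP Eu : node_of (t i) == node_of u by rewrite node_eq.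
  have /eqP Ev : node_of (h i) == node_of v by rewrite node_eq.
  by rewrite -Eu -Ev class_sc.
have labE i : e (h i) v -> class_label (node_of v) = [set w in [set: V] | e (h i) w].
  by move=> hv; have /eqP <- : node_of (h i) == node_of v by rewrite node_eq.
apply/in_distinct_componentsP => //.
  move=> a /scP[i iA [_ _ ->]]; exists (t i); rewrite inE; exact: (tail_cut F).
split=> [a /scP[i iA [_ hv ->]] x y|a b /scP[i iA [Ea hv ->]] /scP[j jA [Eb hv' ->]] ab x y].
  by rewrite !inE (labE _ hv) => xi yi; apply: (in_avoid F).
rewrite !inE (labE _ hv) => xi yj; apply: (in_separated F iA jA) => //.
  by apply: contraNneq ab => ij; rewrite Ea Eb ij.
by apply: e_trans hv _; rewrite e_sym.
Qed.

Let class_outgoing (n : class_node) : in_distinct_components T (class_label n :&: Vp)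
  [pred b | class_arc n b] (fun b => sk class_arc class_label n b).
Proof.
have [v ->] := node_onto n.
have skP a : class_arc (node_of v) a -> exists2 i, i \in A &
    [/\ a = node_of (h i), e (t i) v & sk class_arc class_label (node_of v) a = c i].
  have [u ->] := node_onto a; case/arcP=> i iA [tv hu]; exists i => //.
  have /eqP Eu : node_of (h i) == node_of u by rewrite node_eq.
  have /eqP Ev : node_of (t i) == node_of v by rewrite node_eq.
  by rewrite -Eu -Ev class_sk.
have labE i : e (t i) v -> class_label (node_of v) = [set w in [set: V] | e (t i) w].
  by move=> hv; have /eqP <- : node_of (t i) == node_of v by rewrite node_eq.
apply/in_distinct_componentsP => //.
  by move=> a /skP[i iA [_ _ ->]]; exists (h i); apply: (head_cut F).
split=> [a /skP[i iA [_ hv ->]] x y|a b /skP[i iA [Ea hv ->]] /skP[j jA [Eb hv' ->]] ab x y].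
  by rewrite (labE _ hv) => xi yi; apply: (out_avoid F).
rewrite (labE _ hv) => xi yj; apply: (out_separated F iA jA) => //.
  by apply: contraNneq ab => ij; rewrite Ea Eb ij.
by apply: e_trans hv _; rewrite e_sym.
Qed.

Lemma cut_family_spine : exists S : signed_spine T Vm Vp,
  forall (R : porderType ring_display) (z : V -> R),
  compatible e A t h z <-> forall u v, spine_le S u v -> (z u <= z v)%R.
Proof.
exists (SignedSpine class_arc_tree (val_inj : injective class_label) class_partition
  class_incoming class_outgoing) => R z.
rewrite spine_le_monotone /=; split=> -[zE zA]; split.
- move=> n u v; have [w ->] := node_onto n; rewrite !in_node => wu wv.
  by rewrite -(zE _ _ wu) -(zE _ _ wv).
- move=> m n /exists_inP[i iA]; have [x ->] := node_onto m; have [y ->] := node_onto n.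
  rewrite !in_node => /andP[xt yh] u v; rewrite !in_node => xu yv.
  by rewrite -(zE _ _ xu) -(zE _ _ yv) (zE _ _ xt) (zE _ _ yh) zA.
- by move=> u v uv; apply: (zE (node_of u)); rewrite in_node.
- move=> i iA; by apply: (zA _ _ (arc_of iA)); rewrite in_node; apply: e_refl.
Qed.

End ToSpine.

(** * The fan of spine cones *)

Section Fan.
Local Open Scope ring_scope.
Variables (R : realType) (V : finType) (T : rel V).
Hypothesis treeT : is_tree T.
Notation E := {ffun V -> R^o}.

Definition cut_cone (e : rel V) (I : finType) (A : {set I}) (t h : I -> V) : set E :=
  fun x => H0 R V x /\ compatible e A t h (x : V -> R).

Lemma spine_fanP Vm Vp (C : set E) : spine_fan R T Vm Vp C <->
  exists e (I : finType) (A : {set I}) c t h,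
    cut_family T Vm Vp [set: V] e A c t h /\ C = cut_cone e A t h.
Proof.
split=> [[S ->]|[e [I [A [c [t [h [F ->]]]]]]]].
  have [e [I [A [c [t [h [F FS]]]]]]] := spine_cut_family treeT S.
  exists e, I, A, c, t, h; split=> //; apply/seteqP.
  by split=> x [x0 xS]; split=> //; apply/(FS R x).
have [S FS] := cut_family_spine treeT F; exists S; apply/seteqP.
by split=> x [x0 xS]; split=> //; apply/(FS R x).
Qed.

(** A cone depends only on the relation [spine_le], that is, on one of finitely many subsets of V x
    V. *)
Lemma spine_fan_finite Vm Vp : finite_set (spine_fan R T Vm Vp).
Proof.
pose cone_le (Q : {set V * V}) : set E :=
  fun x => H0 R V x /\ forall u v, (u, v) \in Q -> (x u : R) <= x v.
apply: (@sub_finite_set _ _ (cone_le @` classical_sets.setT)%classic); last first.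
  exact/finite_image/finite_finset.
move=> _ [S ->]; exists [set q | `[< spine_le S q.1 q.2 >]]%SET => //.
apply/seteqP; split=> x [x0 xS]; split=> // u v.
  by move=> uv; apply: xS; rewrite inE; apply/asboolP.
by rewrite inE => /asboolP; apply: xS.
Qed.

Lemma V_gt0 : (0 < #|V|)%N. Proof. by case: treeT. Qed.

Lemma H0_const_eq0 (x : E) : H0 R V x -> (forall u v, x u = x v) -> x = 0.
Proof.
move=> x0 xc; apply/ffunP => u; rewrite ffunE; move: x0; rewrite /H0 /=.
rewrite (eq_bigr (fun=> x u)) // sumr_const => /eqP.
by rewrite mulrn_eq0 eqn0Ngt V_gt0 /= => /eqP.
Qed.

Lemma H0_0 : H0 R V 0.
Proof. by rewrite /H0 /= big1 // => u _; rewrite ffunE. Qed.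

Lemma H0_add (x y : E) : H0 R V x -> H0 R V y -> H0 R V (x + y).
Proof.
rewrite /H0 /= => x0 y0; under eq_bigr do rewrite ffunE.
by rewrite big_split /= x0 y0 addr0.
Qed.

Lemma H0_scale (a : R) (x : E) : H0 R V x -> H0 R V (a *: x).
Proof.
rewrite /H0 /= => x0; under eq_bigr do rewrite ffunE.
by rewrite -scaler_sumr x0 scaler0.
Qed.

Section OneFamily.
Variables (Vm Vp : {set V}) (e : rel V) (I : finType) (A : {set I}).
Variables (c : I -> {set V}) (t h : I -> V).
Hypothesis F : cut_family T Vm Vp [set: V]%SET e A c t h.

Definition ray (C : {set V}) : E := [ffun u => (u \in C)%:R - #|C|%:R / #|V|%:R].

Lemma ray_H0 (C : {set V}) : H0 R V (ray C).
Proof.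
rewrite /H0 /=; under eq_bigr do rewrite ffunE.
have V0 : #|V|%:R != 0 :> R by rewrite pnatr_eq0 -lt0n V_gt0.
have: \sum_(u : V) ((u \in C)%:R - #|C|%:R / #|V|%:R) = 0 :> R; last exact.
rewrite sumrB sumr_const -[_ / _ *+ _]mulr_natr divfK //.
rewrite -natr_sum -[#|C|]sum1_card [in X in _ - X]big_mkcond /=; apply/eqP; rewrite subr_eq0.
by apply/eqP; congr (_%:R); apply: eq_bigr => u _; case: (u \in C).
Qed.

Lemma sum_rayE (k : I -> R) u :
  (\sum_(i in A) k i *: ray (c i)) u = \sum_(i in A) k i * (ray (c i) u : R) :> R.
Proof. by rewrite sum_ffunE; apply: eq_bigr => i _; rewrite ffunE. Qed.

Lemma sum_ray_sub (k : I -> R) u v :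
  let x := \sum_(i in A) k i *: ray (c i) in
  x v - x u = \sum_(i in A) k i * ((v \in c i)%:R - (u \in c i)%:R) :> R.
Proof.
rewrite /= [LHS](_ : _ = \sum_(i in A) (k i * (ray (c i) v : R) - k i * (ray (c i) u : R))).
  by apply: eq_bigr => i _; rewrite !ffunE /=; ring.
by rewrite sumrB -!sum_rayE.
Qed.

Lemma sum_ray_jump (k : I -> R) j : j \in A ->
  let x := \sum_(i in A) k i *: ray (c i) in x (h j) - x (t j) = k j :> R.
Proof.
move=> jA /=; rewrite sum_ray_sub (bigD1 j) //= big1 => [|i /andP[iA ij]].
  by rewrite (jump_cut R F) // eqxx mulr1 addr0.
by rewrite (jump_cut R F) // eq_sym (negPf ij) mulr0.
Qed.

Lemma cut_cone_rays (k : I -> R) : (forall i, i \in A -> 0 <= k i) ->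
  cut_cone e A t h (\sum_(i in A) k i *: ray (c i)).
Proof.
move=> k0; split; last split=> [u v uv|i iA].
- elim/big_rec: _ => [|i x _ x0]; first exact: H0_0.
  by apply: H0_add x0; apply: H0_scale; apply: ray_H0.
- rewrite !sum_ffunE; apply: eq_bigr => i iA; rewrite !ffunE.
  by rewrite (cut_equiv F _ _ uv iA) ?in_setT.
- by rewrite -subr_ge0 sum_ray_jump ?k0.
Qed.

(** Both sides have the same differences between coordinates, so they differ by a constant function,
    which is 0 in the hyperplane. *)
Lemma ray_decomposition (x : E) : cut_cone e A t h x ->
  x = \sum_(i in A) (x (h i) - x (t i) : R) *: ray (c i).
Proof.
move=> [x0 [xe xA]]; apply/eqP; rewrite -subr_eq0; apply/eqP/H0_const_eq0.
  apply: H0_add => //; rewrite -scaleN1r; apply: H0_scale.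
  elim/big_rec: _ => [|i y _ y0]; first exact: H0_0.
  by apply: H0_add y0; apply: H0_scale; apply: ray_H0.
move=> u v; set y := \sum_(i in A) _.
have: x v - x u = y v - y u :> R by rewrite /y sum_ray_sub (sum_jumps treeT F xe).
rewrite !ffunE => xy; apply/eqP; rewrite -subr_eq0; apply/eqP.
have: (x u : R) - y u - (x v - y v) = 0; last exact.
by rewrite -[x v : R](subrK (x u : R)) xy; ring.
Qed.

Lemma cut_cone_simplicial : simplicial_cone (cut_cone e A t h).
Proof.
pose r := enum A; pose s := [seq ray (c i) | i <- r]; exists s.
have size_s : size s = size r by rewrite size_map.
have sum_nth (K : nat -> R) :
    \sum_(i < size s) K i *: s`_i = \sum_(i in A) K (index i r) *: ray (c i).
  rewrite -[RHS]big_enum /= -/r; case Er: r => [|i0 r'].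
    by rewrite big_nil big1 // => -[i]; rewrite size_s Er.
  rewrite -Er (big_nth i0) -size_s big_mkord; apply: eq_bigr => i _.
  by rewrite index_uniq ?enum_uniq -?size_s // (nth_map i0) -?size_s.
(* Coefficients are extended by 0 to all naturals, so that sums over ordinals can be reindexed by
   A. *)
pose ext (K : 'I_(size s) -> R) n := oapp K 0 (insub n).
have extE K (i : 'I_(size s)) : ext K i = K i by rewrite /ext valK.
have sum_ord K : \sum_(i < size s) K i *: s`_i =
    \sum_(i in A) ext K (index i r) *: ray (c i).
  by rewrite -sum_nth; apply: eq_bigr => i _; rewrite extE.
have nth_r (i : 'I_(size s)) : exists2 j, j \in A & index j r = i.
  case Er: r => [|i0 r']; first by case: i => i; rewrite size_s Er.
  exists (nth i0 r i); last by rewrite -Er index_uniq ?enum_uniq -?size_s.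
  by rewrite -mem_enum mem_nth // -/r -size_s.
split.
  apply/(freeP (X := in_tuple s)) => K; rewrite sum_ord => K0 i.
  have [j jA ji] := nth_r i; have := sum_ray_jump (fun j => ext K (index j r)) jA.
  by rewrite /= K0 ji extE !ffunE subrr.
apply/seteqP; split=> x.
  move=> xC; rewrite (ray_decomposition xC).
  pose J n := if r is i0 :: _ then x (h (nth i0 r n)) - x (t (nth i0 r n)) : R else 0.
  exists (fun i => J i); rewrite sum_nth; split=> [i|].
    rewrite /J; case Er: r => [|i0 r'] //; rewrite -Er subr_ge0; apply: xC.2.2.
    by rewrite -mem_enum mem_nth // -/r -size_s.
  apply: eq_bigr => j jA; rewrite /J; have : j \in r by rewrite mem_enum.
  by case Er: r => [|i0 r'] // jr; rewrite nth_index.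
case=> K [K0 ->]; rewrite sum_ord; apply: cut_cone_rays => i iA; rewrite /ext.
by case: insubP => [j _ _|_] /=; rewrite ?K0 ?lexx.
Qed.

Lemma cut_cone_restrict (B : {set I}) (x : E) : B \subset A ->
  cut_cone (unseparated B c) B t h x <->
  cut_cone e A t h x /\ forall i, i \in A -> i \notin B -> x (t i) = x (h i).
Proof.
move=> sBA; split=> [[x0 [xe xB]]|[[x0 [xe xA]] xAB]].
  have xAB i : i \in A -> i \notin B -> x (t i) = x (h i).
    move=> iA iB; apply: xe; apply/unseparatedP => j jB.
    apply: (cut_other F iA); first exact: (subsetP sBA).
    by apply: contraNneq iB => ->.
  split=> //; split=> //; split=> [u v uv|i iA].
    apply: xe; apply/unseparatedP => j /(subsetP sBA) jA.
    by rewrite (cut_equiv F _ _ uv jA) ?in_setT.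
  by have [/xB//|iB] := boolP (i \in B); rewrite xAB.
split=> //; split=> [|i /(subsetP sBA)]; last exact: xA.
exact: (eq_unseparated treeT sBA F xe xAB).
Qed.

(** A form that is nonnegative on the cone is nonnegative on each ray. It vanishes at a point
    exactly when the point has no jump along the arcs whose ray has positive value; B keeps the
    other arcs. *)
Lemma cut_cone_face (G : set E) : face G (cut_cone e A t h) ->
  exists2 B : {set I}, B \subset A & G = cut_cone (unseparated B c) B t h.
Proof.
move=> [f [f0 ->]].
have fray i : i \in A -> 0 <= f (ray (c i)).
  move=> iA; apply: f0; have := @cut_cone_rays (fun j => (j == i)%:R).
  rewrite (bigD1 i) //= big1 ?eqxx => [|j /andP[_ /negPf->]]; last by rewrite scale0r.
  by rewrite scale1r addr0; apply=> j _; apply: ler0n.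
pose B := [set i in A | f (ray (c i)) == 0]%SET.
have sBA : B \subset A by apply/subsetP => i; rewrite inE => /andP[].
have fE x : cut_cone e A t h x ->
    f x = \sum_(i in A) (x (h i) - x (t i) : R) * f (ray (c i)) :> R.
  move=> xC; rewrite {1}(ray_decomposition xC) linear_sum.
  by apply: eq_bigr => i _; rewrite linearZ.
exists B => //; apply/seteqP; split=> x.
  move=> [xC /= fx]; apply/(cut_cone_restrict _ sBA); split=> // i iA iB.
  move: fx; rewrite fE // => /eqP; rewrite psumr_eq0 => [/allP/(_ i (mem_index_enum _))|j jA].
    rewrite iA /= mulf_eq0 => /orP[|fi]; first by rewrite subr_eq0 => /eqP.
    by rewrite inE iA fi in iB.
  by rewrite mulr_ge0 ?fray // subr_ge0; apply: xC.2.2.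
move/(cut_cone_restrict _ sBA) => [xC xAB]; split=> //=; rewrite fE // big1 // => i iA.
have [|iB] := boolP (i \in B); last by rewrite xAB // subrr mul0r.
by rewrite inE => /andP[_ /eqP->]; rewrite mulr0.
Qed.

End OneFamily.

Definition total_jump (I : finType) (B : {set I}) (t h : I -> V) (x : E) : R^o :=
  \sum_(i in B) (x (h i) - x (t i)).

Lemma total_jump_linear (I : finType) (B : {set I}) (t h : I -> V) :
  linear (total_jump B t h).
Proof.
move=> a x y; rewrite /total_jump scaler_sumr -big_split /=; apply: eq_bigr => i _.
by rewrite !ffunE scalerBr addrACA opprD.
Qed.

HB.instance Definition _ (I : finType) (B : {set I}) (t h : I -> V) :=
  GRing.isLinear.Build R E R^o _ (total_jump B t h) (total_jump_linear B t h).

(** Adding up one witness for each jump that can be positive gives a generic point, as nonnegative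
    jumps cannot cancel. *)
Lemma maximal_jumps (P : set E) (s : seq (V * V)) :
  P 0 -> (forall x y, P x -> P y -> P (x + y)) ->
  (forall x q, P x -> q \in s -> (x q.1 : R) <= x q.2) ->
  exists2 x, P x & forall y q, P y -> q \in s -> (y q.1 : R) < y q.2 -> (x q.1 : R) < x q.2.
Proof.
move=> P0 PD; elim: s => [|q s IHs] Ps; first by exists 0.
have [|x Px xs] := IHs; first by move=> x r Px rs; apply: Ps; rewrite // inE rs orbT.
have [[y Py yq]|none] := pselect (exists2 y, P y & (y q.1 : R) < y q.2); last first.
  exists x => // y r Py; rewrite inE => /orP[/eqP-> yq|]; last exact: xs.
  by case: none; exists y.
exists (x + y); first exact: PD.
move=> z r Pz; rewrite inE !ffunE => /orP[/eqP-> _|rs zr].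
  by apply: ler_ltD => //; apply: Ps; rewrite ?inE ?eqxx.
by apply: ltr_leD; [exact: xs zr | apply: Ps; rewrite // inE rs orbT].
Qed.

(** Take a generic x in the intersection and contract, in both families, the arcs along which x does
    not jump. Then x is in the relative interior of both contracted cones, so they agree.
    [total_jump] over the contracted arcs of the first family supports this common face. *)
Lemma cut_cone_inter_face Vm Vp e (I : finType) (A : {set I}) c t h
    e' (I' : finType) (A' : {set I'}) c' t' h' :
  cut_family T Vm Vp [set: V]%SET e A c t h ->
  cut_family T Vm Vp [set: V]%SET e' A' c' t' h' ->
  face (cut_cone e A t h `&` cut_cone e' A' t' h')%classic (cut_cone e A t h).
Proof.
move=> F F'; set C := cut_cone e A t h; set D := cut_cone e' A' t' h'.
pose s := [seq (t i, h i) | i <- enum A] ++ [seq (t' i, h' i) | i <- enum A'].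
have [||x q [xC xD]|x [xC xD] xmax] := @maximal_jumps (C `&` D)%classic s.
- by split; (split; first exact: H0_0); split=> *; rewrite !ffunE.
- move=> x y [[x0 [xe xA]] [_ [xe' xA']]] [[y0 [ye yA]] [_ [ye' yA']]].
  split; split; do ?exact: H0_add; split=> [u v uv|i iA]; rewrite !ffunE.
  + by rewrite (xe _ _ uv) (ye _ _ uv).
  + by apply: lerD; [apply: xA | apply: yA].
  + by rewrite (xe' _ _ uv) (ye' _ _ uv).
  + by apply: lerD; [apply: xA' | apply: yA'].
- rewrite mem_cat => /orP[] /mapP[i]; rewrite mem_enum => iA -> /=; first exact: xC.2.2.
  exact: xD.2.2.
pose B := [set i in A | (x (t i) : R) < x (h i)]%SET.
pose B' := [set i in A' | (x (t' i) : R) < x (h' i)]%SET.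
have sBA : B \subset A by apply/subsetP => i; rewrite inE => /andP[].
have sBA' : B' \subset A' by apply/subsetP => i; rewrite inE => /andP[].
have FB := cut_family_restrict treeT sBA F; have FB' := cut_family_restrict treeT sBA' F'.
have tight i : i \in A -> i \notin B -> x (t i) = x (h i).
  move=> iA; rewrite inE iA /= -leNgt => xi; apply/eqP; rewrite eq_le.
  by apply/andP; split; [exact: xC.2.2 | exact: xi].
have tight' i : i \in A' -> i \notin B' -> x (t' i) = x (h' i).
  move=> iA; rewrite inE iA /= -leNgt => xi; apply/eqP; rewrite eq_le.
  by apply/andP; split; [exact: xD.2.2 | exact: xi].
have xB : strictly_compatible (unseparated B c) B t h (x : V -> R).
  split; last by move=> i; rewrite inE => /andP[].
  exact: (eq_unseparated treeT sBA F xC.2.1 tight).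
have xB' : strictly_compatible (unseparated B' c') B' t' h' (x : V -> R).
  split; last by move=> i; rewrite inE => /andP[].
  exact: (eq_unseparated treeT sBA' F' xD.2.1 tight').
exists (total_jump (A :\: B)%SET t h : {scalar E}).
have ge0 y : C y -> forall i, i \in (A :\: B)%SET -> (0 : R) <= y (h i) - y (t i).
  by move=> yC i; rewrite inE => /andP[_ iA]; rewrite subr_ge0; apply: yC.2.2.
split=> [y yC|]; first by apply: sumr_ge0; apply: ge0.
apply/seteqP; split=> y.
  (* A positive jump of y along an arc outside B would, by genericity, force a positive jump of x
     there. *)
  move=> [yC yD]; split=> //=; rewrite /total_jump big1 // => i; rewrite inE => /andP[iB iA].
  apply/eqP; rewrite subr_eq0 eq_sym; apply/eqP/le_anti/andP; split; first exact: yC.2.2.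
  rewrite leNgt; apply: contra iB => yi; rewrite inE iA /=.
  apply: (xmax y (t i, h i)) => //; rewrite mem_cat; apply/orP; left.
  by apply/mapP; exists i; rewrite ?mem_enum.
move=> [yC /= y0]; split=> //.
have yB : cut_cone (unseparated B c) B t h y.
  apply/(cut_cone_restrict F _ sBA); split=> // i iA iB.
  move/eqP: y0; rewrite /total_jump psumr_eq0; last exact: ge0.
  by move/allP/(_ i (mem_index_enum _)); rewrite inE iA iB /= subr_eq0 => /eqP.
suff: cut_cone (unseparated B' c') B' t' h' y by case/(cut_cone_restrict F' _ sBA').
split; first exact: yB.1.
exact: (strictly_compatible_unique treeT FB FB' xB xB' yB.2).
Qed.

End Fan.

Theorem theorem45 (R : realType) (V : finType) (Vm Vp : {set V}) (T : rel V)
    (Vm_cup_Vp : Vm :|: Vp = [set: V]) (Vm_cap_Vp : Vm :&: Vp = finset.set0)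
    (treeT : is_tree T) :
  simplicial_fan (spine_fan R T Vm Vp) /\
  complete_in (H0 R V) (spine_fan R T Vm Vp).
Proof.
have simplicial C : spine_fan R T Vm Vp C -> simplicial_cone C.
  by case/(spine_fanP treeT) => [e [I [A [c [t [h [F ->]]]]]]]; apply: cut_cone_simplicial F.
split; last first.
  apply/seteqP; split=> [x [_ [S ->] []] // | x x0].
  have [I [A [c [t [h [F xA]]]]]] := spine_on_full treeT Vm Vp (x : V -> R).
  exists (cut_cone eq_op A t h); first by apply/(spine_fanP treeT); exists eq_op, I, A, c, t, h.
  by split=> //; split=> // u v /eqP->.
split; last exact: simplicial.
split=> [|C FC|C G|C D]; first exact: spine_fan_finite.
- by have [s [_ ->]] := simplicial C FC; exists s.
- case/(spine_fanP treeT) => [e [I [A [c [t [h [F ->]]]]]]] /(cut_cone_face treeT F)[B sBA ->].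
  apply/(spine_fanP treeT); exists (unseparated B c), I, B, c, t, h; split=> //.
  exact: (cut_family_restrict treeT sBA F).
case/(spine_fanP treeT) => [e [I [A [c [t [h [F ->]]]]]]].
case/(spine_fanP treeT) => [e' [I' [A' [c' [t' [h' [F' ->]]]]]]].
split; first exact: (cut_cone_inter_face R treeT F F').
by rewrite classical_sets.setIC; exact: (cut_cone_inter_face R treeT F' F).
Qed.
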